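(* The CCV $\lambda\mu$-calculus has the Church–Rosser property: if $M_1=_{ccv}M_2$, then there is a term $N$ with $M_1\to^* N$ and $M_2\to^* N$.
   Context: CCV $\lambda\mu$-calculus. Ordinary variables $x,y,z,\dots$ and continuation variables $k,l,\dots$ form disjoint sets. Terms $M ::= x \mid \lambda x.M \mid MM \mid (M\ \mathsf{where}\ x:=M) \mid \mu k.J$, jumps $J ::= [k]M \mid (J\ \mathsf{where}\ x:=M)$, where $(L\ \mathsf{where}\ x:=M)$ means $\mathsf{let}\ x=M\ \mathsf{in}\ L$; $\lambda x$ binds $x$ in its body, $\mathsf{where}\ x:=M$ binds $x$ in the body $L$ (or $J$) only, $\mu k$ binds $k$. Terms are identified up to $\alpha$-conversion and the congruence generated by (E1) $(L\ \mathsf{where}\ x:=(M\ \mathsf{where}\ y:=N))=((L\ \mathsf{where}\ x:=M)\ \mathsf{where}\ y:=N)$ if $y$ not free in $L$; (E2) $((\mu k.J)\ \mathsf{where}\ x:=M)=\mu k.(J\ \mathsf{where}\ x:=M)$ if $k$ not free in $M$; (E3) $[k](L\ \mathsf{where}\ x:=M)=([k]L\ \mathsf{where}\ x:=M)$. Values $V$: variables and $\lambda$-abstractions; $N$ denotes a non-value. Reduction rules ($z$ fresh): $NM\to(zM\ \mathsf{where}\ z:=N)$; $VN\to(Vz\ \mathsf{where}\ z:=N)$; $(\lambda x.M)V\to(M\ \mathsf{where}\ x:=V)$; $(M\ \mathsf{where}\ x:=V)\to M\{V/x\}$; $(M\ \mathsf{where}\ x:=\mu k.J)\to\mu k.J\{[k]\square\mapsto[k](M\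 \mathsf{where}\ x:=\square)\}$; $[l]\mu k.J\to J\{l/k\}$; $\lambda x.Vx\to V$ ($x$ not free in $V$); $(x\ \mathsf{where}\ x:=M)\to M$; $\mu k.[k]M\to M$ ($k$ not free in $M$). Here $J\{[k]\square\mapsto[k](M\ \mathsf{where}\ x:=\square)\}$ replaces recursively each subjump $[k]Q$ with $k$ free by $[k](M\ \mathsf{where}\ x:=Q)$ (capture-avoiding) and $J\{l/k\}$ replaces each such $[k]Q$ by $[l]Q$. $\to$ is the compatible closure, $\to^*$ its reflexive-transitive closure, and $=_{ccv}$ the smallest congruence containing the rules. *)

(* Defs.v *)
(* CCV lambda-mu calculus with de Bruijn indices.
   Two separate index spaces: ordinary (term) variables and continuation
   variables.  alpha-conversion is built in by the de Bruijn representation. *)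
From Stdlib Require Import Arith Relations.

(* Where L M  represents  (L where x := M)   -- x is term index 0 in L.
   Mu J       represents  mu k. J            -- k is continuation index 0 in J.
   Jmp k M    represents  [k] M.
   JWhere J M represents  (J where x := M)   -- x is term index 0 in J. *)
Inductive term : Type :=
| Var : nat -> term
| Lam : term -> term
| App : term -> term -> term
| Where : term -> term -> term
| Mu : jump -> term
with jump : Type :=
| Jmp : nat -> term -> jump
| JWhere : jump -> term -> jump.

Definition is_value (t : term) : bool :=
  match t with Var _ | Lam _ => true | _ => false end.

Fixpoint shift_t (c : nat) (t : term) : term :=
  match t with
  | Var n => Var (if c <=? n then S n else n)
  | Lam M => Lam (shift_t (S c) M)
  | App M N => App (shift_t c M) (shift_t c N)
  | Where L M => Where (shift_t (S c) L) (shift_t c M)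
  | Mu J => Mu (shift_tj c J)
  end
with shift_tj (c : nat) (J : jump) : jump :=
  match J with
  | Jmp k M => Jmp k (shift_t c M)
  | JWhere J M => JWhere (shift_tj (S c) J) (shift_t c M)
  end.

Fixpoint shift_k (c : nat) (t : term) : term :=
  match t with
  | Var n => Var n
  | Lam M => Lam (shift_k c M)
  | App M N => App (shift_k c M) (shift_k c N)
  | Where L M => Where (shift_k c L) (shift_k c M)
  | Mu J => Mu (shift_kj (S c) J)
  end
with shift_kj (c : nat) (J : jump) : jump :=
  match J with
  | Jmp k M => Jmp (if c <=? k then S k else k) (shift_k c M)
  | JWhere J M => JWhere (shift_kj c J) (shift_k c M)
  end.

(* capture-avoiding substitution of s for ordinary variable j
   (variables above j are decremented: the binder of j disappears) *)
Fixpoint subst_t (j : nat) (s : term) (t : term) : term :=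
  match t with
  | Var n => if n =? j then s else if j <? n then Var (pred n) else Var n
  | Lam M => Lam (subst_t (S j) (shift_t 0 s) M)
  | App M N => App (subst_t j s M) (subst_t j s N)
  | Where L M => Where (subst_t (S j) (shift_t 0 s) L) (subst_t j s M)
  | Mu J => Mu (subst_tj j (shift_k 0 s) J)
  end
with subst_tj (j : nat) (s : term) (J : jump) : jump :=
  match J with
  | Jmp k M => Jmp k (subst_t j s M)
  | JWhere J M => JWhere (subst_tj (S j) (shift_t 0 s) J) (subst_t j s M)
  end.

(* J{l/k}: rename continuation variable j into l (variables above j are
   decremented: the binder of j disappears) *)
Fixpoint rename_k (j l : nat) (t : term) : term :=
  match t with
  | Var n => Var n
  | Lam M => Lam (rename_k j l M)
  | App M N => App (rename_k j l M) (rename_k j l N)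
  | Where L M => Where (rename_k j l L) (rename_k j l M)
  | Mu J => Mu (rename_kj (S j) (S l) J)
  end
with rename_kj (j l : nat) (J : jump) : jump :=
  match J with
  | Jmp k M =>
      Jmp (if k =? j then l else if j <? k then pred k else k) (rename_k j l M)
  | JWhere J M => JWhere (rename_kj j l J) (rename_k j l M)
  end.

(* structural substitution  J{[k]Q |-> [k](M where x := Q)}, k = continuation
   index e; M has x as ordinary index 0.  Applied recursively inside Q. *)
Fixpoint ssub_t (e : nat) (M : term) (t : term) : term :=
  match t with
  | Var n => Var n
  | Lam P => Lam (ssub_t e (shift_t 1 M) P)
  | App P Q => App (ssub_t e M P) (ssub_t e M Q)
  | Where P Q => Where (ssub_t e (shift_t 1 M) P) (ssub_t e M Q)
  | Mu J => Mu (ssub_j (S e) (shift_k 0 M) J)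
  end
with ssub_j (e : nat) (M : term) (J : jump) : jump :=
  match J with
  | Jmp k Q =>
      if k =? e then Jmp k (Where M (ssub_t e M Q)) else Jmp k (ssub_t e M Q)
  | JWhere J Q => JWhere (ssub_j e (shift_t 1 M) J) (ssub_t e M Q)
  end.

Inductive eq_ax_t : term -> term -> Prop :=
| E1 : forall L M N,                       (* y not free in L *)
    eq_ax_t (Where L (Where M N)) (Where (Where (shift_t 1 L) M) N)
| E2 : forall J M,                         (* k not free in M *)
    eq_ax_t (Where (Mu J) M) (Mu (JWhere J (shift_k 0 M))).

Inductive eq_ax_j : jump -> jump -> Prop :=
| E1j : forall J M N,
    eq_ax_j (JWhere J (Where M N)) (JWhere (JWhere (shift_tj 1 J) M) N)
| E3 : forall k L M,
    eq_ax_j (Jmp k (Where L M)) (JWhere (Jmp k L) M).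

Inductive ec_t : term -> term -> Prop :=
| ec_ax : forall M N, eq_ax_t M N -> ec_t M N
| ec_lam : forall M M', ec_t M M' -> ec_t (Lam M) (Lam M')
| ec_appl : forall M M' N, ec_t M M' -> ec_t (App M N) (App M' N)
| ec_appr : forall M N N', ec_t N N' -> ec_t (App M N) (App M N')
| ec_wherel : forall L L' M, ec_t L L' -> ec_t (Where L M) (Where L' M)
| ec_wherer : forall L M M', ec_t M M' -> ec_t (Where L M) (Where L M')
| ec_mu : forall J J', ec_j J J' -> ec_t (Mu J) (Mu J')
with ec_j : jump -> jump -> Prop :=
| ecj_ax : forall J J', eq_ax_j J J' -> ec_j J J'
| ecj_jmp : forall k M M', ec_t M M' -> ec_j (Jmp k M) (Jmp k M')
| ecj_wherel : forall J J' M, ec_j J J' -> ec_j (JWhere J M) (JWhere J' M)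
| ecj_wherer : forall J M M', ec_t M M' -> ec_j (JWhere J M) (JWhere J M').

Definition cong (M N : term) : Prop := clos_refl_sym_trans term ec_t M N.

Inductive step_t : term -> term -> Prop :=
| r_app_nv : forall N M, is_value N = false ->
    step_t (App N M) (Where (App (Var 0) (shift_t 0 M)) N)
| r_app_vn : forall V N, is_value V = true -> is_value N = false ->
    step_t (App V N) (Where (App (shift_t 0 V) (Var 0)) N)
| r_beta : forall M V, is_value V = true ->
    step_t (App (Lam M) V) (Where M V)
| r_where_val : forall M V, is_value V = true ->
    step_t (Where M V) (subst_t 0 V M)
| r_where_mu : forall M J,
    step_t (Where M (Mu J)) (Mu (ssub_j 0 (shift_k 0 M) J))
| r_eta : forall V, is_value V = true ->          (* x not free in V *)
    step_t (Lam (App (shift_t 0 V) (Var 0))) V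
| r_where_var : forall M,
    step_t (Where (Var 0) M) M
| r_mu_jmp : forall M,                            (* k not free in M *)
    step_t (Mu (Jmp 0 (shift_k 0 M))) M
| s_lam : forall M M', step_t M M' -> step_t (Lam M) (Lam M')
| s_appl : forall M M' N, step_t M M' -> step_t (App M N) (App M' N)
| s_appr : forall M N N', step_t N N' -> step_t (App M N) (App M N')
| s_wherel : forall L L' M, step_t L L' -> step_t (Where L M) (Where L' M)
| s_wherer : forall L M M', step_t M M' -> step_t (Where L M) (Where L M')
| s_mu : forall J J', step_j J J' -> step_t (Mu J) (Mu J')
with step_j : jump -> jump -> Prop :=
| r_jmp_mu : forall l J,
    step_j (Jmp l (Mu J)) (rename_kj 0 l J)
| sj_jmp : forall k M M', step_t M M' -> step_j (Jmp k M) (Jmp k M')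
| sj_wherel : forall J J' M, step_j J J' -> step_j (JWhere J M) (JWhere J' M)
| sj_wherer : forall J M M', step_t M M' -> step_j (JWhere J M) (JWhere J M').

Definition red (M N : term) : Prop :=
  exists M' N', cong M M' /\ step_t M' N' /\ cong N' N.

(* reflexive-transitive closure (reflexivity is modulo the identification) *)
Definition reds (M N : term) : Prop :=
  clos_refl_trans term (fun a b => red a b \/ cong a b) M N.

Definition ccv_eq (M N : term) : Prop :=
  clos_refl_sym_trans term (fun a b => step_t a b \/ cong a b) M N.

(* Main.v *)
(** A CPS translation sends terms into an untyped lambda-calculus over the same two
    kinds of variables, where the structural congruence and all reductions become
    beta-eta conversions. That calculus is confluent, as its parallel reduction has the
    diamond property.

    Conversely CPS terms are read back in direct style: an abstraction over a continuation
    becomes a [Mu], and a continuation a context [[k](M where x := _)]. Beta and eta steps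
    between CPS terms are simulated by source reductions, and every term reduces to the
    read-back of its translation; hence a common reduct of two translations yields a common
    reduct of the terms. As a term does not reduce to [mu k.[k]M], the read-back has to
    contract such terms whenever possible, and the crux is that this contraction is
    compatible with reduction. *)
Require Import Defs.
From Stdlib Require Import Arith Relations Lia FunctionalExtensionality Wf_nat.
From Stdlib Require Import Relations_3_facts.

(** * Closures of relations *)

Lemma clos_rt_eq {A} (R : relation A) a b : a = b -> clos_refl_trans A R a b.
Proof. intros ->. apply rt_refl. Qed.

Lemma clos_rst_eq {A} (R : relation A) a b : a = b -> clos_refl_sym_trans A R a b.
Proof. intros ->. apply rst_refl. Qed.

Lemma clos_rt_map {A B} (R : relation A) (S : relation B) (f : A -> B) :
  (forall a b, R a b -> clos_refl_trans B S (f a) (f b)) ->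
  forall a b, clos_refl_trans A R a b -> clos_refl_trans B S (f a) (f b).
Proof.
  intros H a b. induction 1; [auto|apply rt_refl|eapply rt_trans; eassumption].
Qed.

Lemma clos_rst_map {A B} (R : relation A) (S : relation B) (f : A -> B) :
  (forall a b, R a b -> clos_refl_sym_trans B S (f a) (f b)) ->
  forall a b, clos_refl_sym_trans A R a b -> clos_refl_sym_trans B S (f a) (f b).
Proof.
  intros H a b.
  induction 1; [auto|apply rst_refl|now apply rst_sym|eapply rst_trans; eassumption].
Qed.

Lemma strongly_confluent_church_rosser {A} (R : relation A) : Strongly_confluent A R ->
  forall a b, clos_refl_sym_trans A R a b -> coherent A R a b.
Proof.
  intros D a b H.
  induction H as [a b H|a|a b _ IH|a b c _ [d [Ha Hb]] _ [e [Hb' Hc]]].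
  - exists b. split; [now apply Rstar_contains_R|apply Rstar_0].
  - exists a. split; apply Rstar_0.
  - now apply coherent_symmetric.
  - destruct (Strong_confluence A R D b d e Hb Hb') as [f [? ?]].
    exists f. split; eapply Rstar_transitive; eassumption.
Qed.

(** * Renamings of two kinds of variables *)

Variant kind := Ord | Cont.

Definition renaming : Type := kind -> nat -> nat.

Definition scons {A} (a : A) (f : nat -> A) (n : nat) : A :=
  match n with 0 => a | S m => f m end.

Definition kcons {A} (k : kind) (a : A) (f : kind -> nat -> A) (k' : kind) : nat -> A :=
  match k, k' with
  | Ord, Ord | Cont, Cont => scons a (f k')
  | _, _ => f k'
  end.

Definition on_kind (k : kind) (f : nat -> nat) : renaming := fun k' n =>
  match k, k' with
  | Ord, Ord | Cont, Cont => f n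
  | _, _ => n
  end.

Definition idr : renaming := fun _ n => n.
Definition shift (k : kind) : renaming := on_kind k S.
Definition up (k : kind) (r : renaming) : renaming :=
  kcons k 0 (fun k' n => shift k k' (r k' n)).

Ltac case_kinds := repeat match goal with k : kind |- _ => destruct k end.
Ltac ext_var :=
  let k := fresh "k" in let n := fresh "n" in
  extensionality k; extensionality n; case_kinds; destruct n; simpl; try reflexivity.

Lemma up_id k : up k idr = idr.
Proof. ext_var. Qed.

Lemma up_comm k k' r : up k (up k' r) = up k' (up k r).
Proof. ext_var. Qed.

Lemma up_comp k r r' :
  (fun k' n => up k r' k' (up k r k' n)) = up k (fun k' n => r' k' (r k' n)).
Proof. ext_var. Qed.

(** * The untyped lambda-calculus over two kinds of variables *)

Inductive tm : Type :=
| var : kind -> nat -> tm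
| abs : kind -> tm -> tm
| app : kind -> tm -> tm -> tm.

Fixpoint ren (r : renaming) (t : tm) : tm :=
  match t with
  | var k n => var k (r k n)
  | abs k t => abs k (ren (up k r) t)
  | app k t u => app k (ren r t) (ren r u)
  end.

Notation wk k := (ren (shift k)).

Definition subst : Type := kind -> nat -> tm.

Definition lift (k : kind) (s : subst) : subst :=
  kcons k (var k 0) (fun k' n => wk k (s k' n)).

Fixpoint sub (s : subst) (t : tm) : tm :=
  match t with
  | var k n => s k n
  | abs k t => abs k (sub (lift k s) t)
  | app k t u => app k (sub s t) (sub s u)
  end.

Definition inst (k : kind) (u : tm) : subst := kcons k u var.

Lemma ren_id t : ren idr t = t.
Proof.
  induction t as [k n|k t IH|k t IHt u IHu]; simpl;
    [reflexivity|rewrite up_id|]; congruence.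
Qed.

Lemma ren_ren t : forall r r', ren r' (ren r t) = ren (fun k n => r' k (r k n)) t.
Proof.
  induction t as [k n|k t IH|k t IHt u IHu]; intros r r'; simpl;
    [reflexivity| |now rewrite IHt, IHu].
  now rewrite IH, up_comp.
Qed.

Lemma ren_up_wk k r t : ren (up k r) (wk k t) = wk k (ren r t).
Proof. rewrite !ren_ren. f_equal. ext_var. Qed.

Lemma sub_ren t : forall r s, sub s (ren r t) = sub (fun k n => s k (r k n)) t.
Proof.
  induction t as [k n|k t IH|k t IHt u IHu]; intros r s; simpl;
    [reflexivity| |now rewrite IHt, IHu].
  rewrite IH. do 2 f_equal. ext_var.
Qed.

Lemma ren_sub t : forall r s, ren r (sub s t) = sub (fun k n => ren r (s k n)) t.
Proof.
  induction t as [k n|k t IH|k t IHt u IHu]; intros r s; simpl;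
    [reflexivity| |now rewrite IHt, IHu].
  rewrite IH. do 2 f_equal. ext_var; apply ren_up_wk.
Qed.

Lemma sub_lift_wk k s t : sub (lift k s) (wk k t) = wk k (sub s t).
Proof. rewrite sub_ren, ren_sub. f_equal. ext_var. Qed.

Lemma sub_sub t : forall s s', sub s' (sub s t) = sub (fun k n => sub s' (s k n)) t.
Proof.
  induction t as [k n|k t IH|k t IHt u IHu]; intros s s'; simpl;
    [reflexivity| |now rewrite IHt, IHu].
  rewrite IH. do 2 f_equal. ext_var; apply sub_lift_wk.
Qed.

Lemma sub_var_ren t : forall r, sub (fun k n => var k (r k n)) t = ren r t.
Proof.
  induction t as [k n|k t IH|k t IHt u IHu]; intro r; simpl;
    [reflexivity| |now rewrite IHt, IHu].
  rewrite <- IH. do 2 f_equal. ext_var.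
Qed.

Lemma sub_id t : sub var t = t.
Proof. rewrite <- (ren_id t) at 2. apply sub_var_ren. Qed.

Lemma sub_inst_wk k u t : sub (inst k u) (wk k t) = t.
Proof.
  rewrite sub_ren. rewrite <- (sub_id t) at 2. f_equal. ext_var.
Qed.

Lemma sub_sub_inst k s u t :
  sub s (sub (inst k u) t) = sub (inst k (sub s u)) (sub (lift k s) t).
Proof.
  rewrite !sub_sub. f_equal. ext_var; symmetry; apply sub_inst_wk.
Qed.

Lemma ren_sub_inst k r u t :
  ren r (sub (inst k u) t) = sub (inst k (ren r u)) (ren (up k r) t).
Proof. rewrite ren_sub, sub_ren. f_equal. ext_var. Qed.

Lemma sub_inst_var_up k t : sub (inst k (var k 0)) (ren (up k (shift k)) t) = t.
Proof. rewrite sub_ren. rewrite <- (sub_id t) at 2. f_equal. ext_var. Qed.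

Lemma wk_inj k t u : wk k t = wk k u -> t = u.
Proof.
  intro E. apply (f_equal (sub (inst k (var k 0)))) in E. now rewrite !sub_inst_wk in E.
Qed.

(** * Confluence of beta-eta *)

Definition eta_body (k : kind) (t : tm) : tm := app k (wk k t) (var k 0).

Arguments eta_body : simpl never.

Inductive par : tm -> tm -> Prop :=
| par_var k n : par (var k n) (var k n)
| par_abs k t t' : par t t' -> par (abs k t) (abs k t')
| par_app k t t' u u' : par t t' -> par u u' -> par (app k t u) (app k t' u')
| par_beta k t t' u u' : par t t' -> par u u' ->
    par (app k (abs k t) u) (sub (inst k u') t')
| par_eta k t t' : par t t' -> par (abs k (eta_body k t)) t'.

Lemma par_refl t : par t t.
Proof. induction t; now constructor. Qed.

Lemma ren_eta_body k r t : ren (up k r) (eta_body k t) = eta_body k (ren r t).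
Proof. unfold eta_body. simpl. rewrite ren_up_wk. f_equal. now destruct k. Qed.

Lemma sub_eta_body k s t : sub (lift k s) (eta_body k t) = eta_body k (sub s t).
Proof. unfold eta_body. simpl. rewrite sub_lift_wk. f_equal. now destruct k. Qed.

Lemma sub_inst_eta_body k u t : sub (inst k u) (eta_body k t) = app k t u.
Proof. unfold eta_body. simpl. rewrite sub_inst_wk. now destruct k. Qed.

Lemma par_ren t t' : par t t' -> forall r, par (ren r t) (ren r t').
Proof.
  induction 1; intro r; cbn; try solve [constructor; auto].
  - rewrite ren_sub_inst. now constructor.
  - rewrite ren_eta_body. now constructor.
Qed.

Lemma par_lift k s s' : (forall k n, par (s k n) (s' k n)) ->
  forall k' n, par (lift k s k' n) (lift k s' k' n).
Proof. intros H k' n. case_kinds; destruct n; try constructor; now apply par_ren. Qed.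

Lemma par_sub t t' : par t t' -> forall s s', (forall k n, par (s k n) (s' k n)) ->
  par (sub s t) (sub s' t').
Proof.
  induction 1; intros s s' Hs; cbn; auto; try solve [constructor; auto using par_lift].
  - rewrite sub_sub_inst. constructor; auto using par_lift.
  - rewrite sub_eta_body. constructor; auto.
Qed.

Lemma par_inst k t t' u u' : par t t' -> par u u' ->
  par (sub (inst k u) t) (sub (inst k u') t').
Proof.
  intros Ht Hu. apply par_sub; [assumption|].
  intros k' n. case_kinds; destruct n; simpl; trivial; constructor.
Qed.

(* Two renamings with a common value factor through their pullback; this inverts
   weakening without a notion of free variable. *)
Definition pullback (r1 r2 p1 p2 : renaming) : Prop :=
  forall k m n, r1 k m = r2 k n -> exists i, m = p1 k i /\ n = p2 k i.

Lemma pullback_up k r1 r2 p1 p2 :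
  pullback r1 r2 p1 p2 -> pullback (up k r1) (up k r2) (up k p1) (up k p2).
Proof.
  intros H k' m n E. destruct k, k'; simpl in *; auto; destruct m, n; simpl in *;
    try discriminate; try (now exists 0);
    injection E as E; destruct (H _ _ _ E) as [i [-> ->]]; now exists (S i).
Qed.

Lemma pullback_shift k r : pullback (up k r) (shift k) (shift k) r.
Proof.
  intros k' m n E. case_kinds; simpl in *; try (now exists m);
    destruct m; try discriminate; injection E as <-; now exists m.
Qed.

Lemma ren_pullback t : forall u r1 r2 p1 p2, pullback r1 r2 p1 p2 ->
  ren r1 t = ren r2 u -> exists w, t = ren p1 w /\ u = ren p2 w.
Proof.
  induction t as [k n|k t IH|k t1 IH1 t2 IH2]; intros [k' n'|k' u|k' u1 u2] r1 r2 p1 p2 P E;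
    try discriminate.
  - injection E as <- E. destruct (P _ _ _ E) as [i [-> ->]]. now exists (var k i).
  - injection E as <- E.
    destruct (IH _ _ _ _ _ (pullback_up k _ _ _ _ P) E) as [w [-> ->]].
    now exists (abs k w).
  - injection E as <- E1 E2.
    destruct (IH1 _ _ _ _ _ P E1) as [w1 [-> ->]].
    destruct (IH2 _ _ _ _ _ P E2) as [w2 [-> ->]].
    now exists (app k w1 w2).
Qed.

Lemma ren_eta_body_inv k r t u : ren (up k r) t = eta_body k u ->
  exists w, t = eta_body k w /\ u = ren r w.
Proof.
  destruct t as [| |k' t [k0 n| |]]; try discriminate. intro E. injection E as -> Ht -> Hn.
  destruct (ren_pullback _ _ _ _ _ _ (pullback_shift k r) Ht) as [w [-> ->]].
  exists w. split; [|reflexivity]. unfold eta_body. do 2 f_equal.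
  destruct k, n; now try discriminate.
Qed.

Lemma par_ren_inv t u : par t u -> forall w r, t = ren r w ->
  exists w', u = ren r w' /\ par w w'.
Proof.
  induction 1 as [k n|k t t' _ IH|k t t' u u' _ IHt _ IHu|k t t' u u' _ IHt _ IHu
    |k t t' _ IH]; intros w r E.
  - exists w. split; [assumption|apply par_refl].
  - destruct w as [|k' w|]; try discriminate. injection E as <- E.
    destruct (IH _ _ E) as [w' [-> Hw]].
    exists (abs k w'). split; [reflexivity|now constructor].
  - destruct w as [| |k' w1 w2]; try discriminate. injection E as <- E1 E2.
    destruct (IHt _ _ E1) as [w1' [-> H1]]. destruct (IHu _ _ E2) as [w2' [-> H2]].
    exists (app k w1' w2'). split; [reflexivity|now constructor].
  - destruct w as [| |k' [|k'' w1|] w2]; try discriminate. injection E as <- <- E1 E2.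
    destruct (IHt _ _ E1) as [w1' [-> H1]]. destruct (IHu _ _ E2) as [w2' [-> H2]].
    exists (sub (inst k w2') w1'). split; [now rewrite ren_sub_inst|now constructor].
  - destruct w as [|k' w|]; try discriminate. injection E as <- E. symmetry in E.
    apply ren_eta_body_inv in E as [w' [-> ->]].
    destruct (IH _ _ eq_refl) as [w'' [-> Hw]].
    exists w''. split; [reflexivity|now constructor].
Qed.

Lemma par_abs_inv k t u : par (abs k t) u ->
  (exists t', u = abs k t' /\ par t t') \/ (exists s, t = eta_body k s /\ par s u).
Proof. inversion 1; eauto. Qed.

Lemma par_app_inv k t u v : par (app k t u) v -> exists u', par u u' /\
  ((exists t', v = app k t' u' /\ par t t') \/
   (exists b b', t = abs k b /\ v = sub (inst k u') b' /\ par b b')).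
Proof. inversion 1; subst; eauto 9. Qed.

Lemma par_eta_body_inv k t u : par (eta_body k t) u ->
  (exists t', u = eta_body k t' /\ par t t') \/ (exists b, t = abs k b /\ par b u).
Proof.
  intro H. apply par_app_inv in H as [v [Hv H]]. inversion Hv; subst.
  destruct H as [[s [-> Hs]]|[b [b' [E [-> Hb]]]]].
  - left. destruct (par_ren_inv _ _ Hs _ _ eq_refl) as [w [-> Hw]]. now exists w.
  - right. destruct t as [|k' b0|]; try discriminate. injection E as -> <-.
    destruct (par_ren_inv _ _ Hb _ _ eq_refl) as [w [-> Hw]].
    exists b0. split; [reflexivity|]. now rewrite sub_inst_var_up.
Qed.

Definition joinable {A} (R : relation A) (b c : A) : Prop := exists d, R b d /\ R c d.
Definition diamond_at {A} (R : relation A) (a : A) : Prop :=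
  forall b c, R a b -> R a c -> joinable R b c.

Lemma joinable_sym {A} (R : relation A) b c : joinable R b c -> joinable R c b.
Proof. intros [d [Hb Hc]]. now exists d. Qed.

Fixpoint size (t : tm) : nat :=
  match t with
  | var _ _ => 0
  | abs _ t => S (size t)
  | app _ t u => S (size t + size u)
  end.

Lemma size_ren t : forall r, size (ren r t) = size t.
Proof. induction t; intro r; simpl; auto. Qed.

Lemma size_eta_body k t : size (eta_body k t) = S (size t).
Proof. unfold eta_body. simpl. rewrite size_ren. lia. Qed.

Lemma par_eta_diamond k t t' u : diamond_at par t -> par t t' -> par (eta_body k t) u ->
  joinable par (abs k u) t'.
Proof.
  intros D Ht Hu. apply par_eta_body_inv in Hu as [[w [-> Hw]]|[b [-> Hb]]].
  - destruct (D _ _ Hw Ht) as [d [H1 H2]]. exists d. split; [now constructor|assumption].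
  - apply D; [now constructor|assumption].
Qed.

(* When the function is also an eta-redex, both reducts are reducts of the
   eta-contracted application, which is smaller but not a subterm. *)
Lemma par_beta_diamond k t t' u u1 u2 f :
  (forall s, size s < size (app k (abs k t) u) -> diamond_at par s) ->
  par (abs k t) f -> par t t' -> par u u1 -> par u u2 ->
  joinable par (app k f u1) (sub (inst k u2) t').
Proof.
  simpl. intros IH Hf Ht Hu1 Hu2. apply par_abs_inv in Hf as [[t1 [-> Ht1]]|[s [-> Hs]]].
  - destruct (IH t ltac:(lia) _ _ Ht1 Ht) as [d [? ?]].
    destruct (IH u ltac:(lia) _ _ Hu1 Hu2) as [e [? ?]].
    exists (sub (inst k e) d). split; [now constructor|now apply par_inst].
  - rewrite size_eta_body in IH.
    apply (IH (app k s u)); [simpl; lia|now constructor|].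
    apply par_eta_body_inv in Ht as [[w [-> Hw]]|[b [-> Hb]]].
    + rewrite sub_inst_eta_body. now constructor.
    + now constructor.
Qed.

Lemma par_abs_diamond k t :
  (forall s, size s < size (abs k t) -> diamond_at par s) -> diamond_at par (abs k t).
Proof.
  simpl. intros IH t1 t2 H1 H2.
  destruct (par_abs_inv _ _ _ H1) as [[b1 [-> Hb1]]|[s1 [-> Hs1]]],
    (par_abs_inv _ _ _ H2) as [[b2 [-> Hb2]]|[s2 [E2 Hs2]]].
  - destruct (IH t ltac:(lia) _ _ Hb1 Hb2) as [d [? ?]].
    exists (abs k d). split; now constructor.
  - subst t. rewrite size_eta_body in IH.
    apply par_eta_diamond with s2; trivial. apply IH. lia.
  - rewrite size_eta_body in IH.
    apply joinable_sym, par_eta_diamond with s1; trivial. apply IH. lia.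
  - rewrite size_eta_body in IH. injection E2 as E2. apply wk_inj in E2. subst s2.
    apply (IH s1); [lia|assumption|assumption].
Qed.

Lemma par_app_diamond k t u :
  (forall s, size s < size (app k t u) -> diamond_at par s) -> diamond_at par (app k t u).
Proof.
  intros IH v1 v2 H1 H2.
  apply par_app_inv in H1 as [u1 [Hu1 H1]]. apply par_app_inv in H2 as [u2 [Hu2 H2]].
  destruct (IH u ltac:(simpl; lia) _ _ Hu1 Hu2) as [e [? ?]].
  destruct H1 as [[t1 [-> Ht1]]|[b [b1 [-> [-> Hb1]]]]],
    H2 as [[t2 [-> Ht2]]|[b' [b2 [E2 [-> Hb2]]]]].
  - destruct (IH t ltac:(simpl; lia) _ _ Ht1 Ht2) as [d [? ?]].
    exists (app k d e). split; now constructor.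
  - subst t. eapply par_beta_diamond; eassumption.
  - apply joinable_sym. eapply par_beta_diamond; eassumption.
  - injection E2 as <-. destruct (IH b ltac:(simpl; lia) _ _ Hb1 Hb2) as [d [? ?]].
    exists (sub (inst k e) d). split; now apply par_inst.
Qed.

Lemma par_diamond : Strongly_confluent tm par.
Proof.
  intro t. induction t as [t IH] using (well_founded_ind (well_founded_ltof _ size)).
  unfold ltof in IH. destruct t as [k n|k t|k t u].
  - intros t1 t2 H1 H2. inversion H1; inversion H2; subst.
    exists (var k n). split; constructor.
  - now apply par_abs_diamond.
  - now apply par_app_diamond.
Qed.

Definition conv : relation tm := clos_refl_sym_trans tm par.

Lemma conv_beta k t u : conv (app k (abs k t) u) (sub (inst k u) t).
Proof. apply rst_step, par_beta; apply par_refl. Qed.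

Lemma conv_eta k t : conv (abs k (eta_body k t)) t.
Proof. apply rst_step, par_eta, par_refl. Qed.

Lemma conv_abs k t t' : conv t t' -> conv (abs k t) (abs k t').
Proof. apply clos_rst_map. intros. now apply rst_step, par_abs. Qed.

Lemma conv_app k t t' u u' : conv t t' -> conv u u' -> conv (app k t u) (app k t' u').
Proof.
  intros Ht Hu. apply rst_trans with (app k t' u).
  - revert Ht. apply (clos_rst_map _ _ (fun v => app k v u)).
    intros. apply rst_step, par_app; [assumption|apply par_refl].
  - revert Hu. apply clos_rst_map.
    intros. apply rst_step, par_app; [apply par_refl|assumption].
Qed.

Lemma conv_sub s t t' : conv t t' -> conv (sub s t) (sub s t').
Proof. apply clos_rst_map. intros. apply rst_step, par_sub; auto using par_refl. Qed.

Lemma conv_ren r t t' : conv t t' -> conv (ren r t) (ren r t').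
Proof. apply clos_rst_map. intros. now apply rst_step, par_ren. Qed.

Lemma conv_app_wk_abs k t : conv (app k (wk k (abs k t)) (var k 0)) t.
Proof.
  simpl. eapply rst_trans; [apply conv_beta|]. rewrite sub_inst_var_up. apply rst_refl.
Qed.

(** * Simultaneous renaming and substitution of source terms *)

Fixpoint ren_term (r : renaming) (t : term) : term :=
  match t with
  | Var n => Var (r Ord n)
  | Lam M => Lam (ren_term (up Ord r) M)
  | App M N => App (ren_term r M) (ren_term r N)
  | Where L M => Where (ren_term (up Ord r) L) (ren_term r M)
  | Mu J => Mu (ren_jump (up Cont r) J)
  end
with ren_jump (r : renaming) (J : jump) : jump :=
  match J with
  | Jmp k M => Jmp (r Cont k) (ren_term r M)
  | JWhere J M => JWhere (ren_jump (up Ord r) J) (ren_term r M)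
  end.

(* [jmp_ctx l] stands for [l]_ and [where_ctx l L] for [l](L where x := _). *)
Variant ctx : Type :=
| jmp_ctx : nat -> ctx
| where_ctx : nat -> term -> ctx.

Definition fill (a : ctx) (t : term) : jump :=
  match a with
  | jmp_ctx l => Jmp l t
  | where_ctx l L => Jmp l (Where L t)
  end.

Definition ren_ctx (r : renaming) (a : ctx) : ctx :=
  match a with
  | jmp_ctx l => jmp_ctx (r Cont l)
  | where_ctx l L => where_ctx (r Cont l) (ren_term (up Ord r) L)
  end.

Notation wk_term k := (ren_term (shift k)).
Notation wk_ctx k := (ren_ctx (shift k)).

Definition lift_terms (k : kind) (s : nat -> term) : nat -> term :=
  match k with
  | Ord => scons (Var 0) (fun n => wk_term Ord (s n))
  | Cont => fun n => wk_term Cont (s n)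
  end.

Definition lift_ctxs (k : kind) (c : nat -> ctx) : nat -> ctx :=
  match k with
  | Ord => fun n => wk_ctx Ord (c n)
  | Cont => scons (jmp_ctx 0) (fun n => wk_ctx Cont (c n))
  end.

Arguments lift_terms : simpl never.
Arguments lift_ctxs : simpl never.

Fixpoint sub_term (s : nat -> term) (c : nat -> ctx) (t : term) : term :=
  match t with
  | Var n => s n
  | Lam M => Lam (sub_term (lift_terms Ord s) (lift_ctxs Ord c) M)
  | App M N => App (sub_term s c M) (sub_term s c N)
  | Where L M => Where (sub_term (lift_terms Ord s) (lift_ctxs Ord c) L) (sub_term s c M)
  | Mu J => Mu (sub_jump (lift_terms Cont s) (lift_ctxs Cont c) J)
  end
with sub_jump (s : nat -> term) (c : nat -> ctx) (J : jump) : jump :=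
  match J with
  | Jmp k M => fill (c k) (sub_term s c M)
  | JWhere J M => JWhere (sub_jump (lift_terms Ord s) (lift_ctxs Ord c) J) (sub_term s c M)
  end.

Lemma ren_term_id (t : term) : ren_term idr t = t
with ren_jump_id (J : jump) : ren_jump idr J = J.
Proof.
  - destruct t; simpl; rewrite ?up_id, ?ren_term_id, ?ren_jump_id; reflexivity.
  - destruct J; simpl; rewrite ?up_id, ?ren_term_id, ?ren_jump_id; reflexivity.
Qed.

Lemma ren_term_ren (t : term) : forall r r',
  ren_term r' (ren_term r t) = ren_term (fun k n => r' k (r k n)) t
with ren_jump_ren (J : jump) : forall r r',
  ren_jump r' (ren_jump r J) = ren_jump (fun k n => r' k (r k n)) J.
Proof.
  - destruct t; intros r r'; simpl;
      rewrite ?ren_term_ren, ?ren_jump_ren, ?up_comp; reflexivity.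
  - destruct J; intros r r'; simpl;
      rewrite ?ren_term_ren, ?ren_jump_ren, ?up_comp; reflexivity.
Qed.

Lemma ren_up_wk_term k r t : ren_term (up k r) (wk_term k t) = wk_term k (ren_term r t).
Proof. rewrite !ren_term_ren. f_equal. ext_var. Qed.

Lemma ren_up_wk_ctx k r a : ren_ctx (up k r) (wk_ctx k a) = wk_ctx k (ren_ctx r a).
Proof.
  destruct a; simpl; [now destruct k|].
  rewrite !ren_term_ren. f_equal; [now destruct k|]. f_equal. ext_var.
Qed.

Lemma ren_jump_fill r a t : ren_jump r (fill a t) = fill (ren_ctx r a) (ren_term r t).
Proof. now destruct a. Qed.

Lemma lift_terms_up k s r :
  (fun n => lift_terms k s (up k r Ord n)) = lift_terms k (fun n => s (r Ord n)).
Proof. destruct k; [|reflexivity]. extensionality n. now destruct n. Qed.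

Lemma lift_ctxs_up k c r :
  (fun n => lift_ctxs k c (up k r Cont n)) = lift_ctxs k (fun n => c (r Cont n)).
Proof. destruct k; [reflexivity|]. extensionality n. now destruct n. Qed.

Lemma ren_lift_terms k r s : (fun n => ren_term (up k r) (lift_terms k s n))
  = lift_terms k (fun n => ren_term r (s n)).
Proof.
  extensionality n. destruct k; [destruct n; [reflexivity|]|]; apply ren_up_wk_term.
Qed.

Lemma ren_lift_ctxs k r c : (fun n => ren_ctx (up k r) (lift_ctxs k c n))
  = lift_ctxs k (fun n => ren_ctx r (c n)).
Proof.
  extensionality n. destruct k; [|destruct n; [reflexivity|]]; apply ren_up_wk_ctx.
Qed.

Lemma lift_terms_Var k : lift_terms k Var = Var.
Proof. destruct k; [|reflexivity]. extensionality n. now destruct n. Qed.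

Lemma lift_ctxs_jmp_ctx k : lift_ctxs k jmp_ctx = jmp_ctx.
Proof. destruct k; [reflexivity|]. extensionality n. now destruct n. Qed.

Lemma sub_term_ren (t : term) : forall r s c,
  sub_term s c (ren_term r t) = sub_term (fun n => s (r Ord n)) (fun n => c (r Cont n)) t
with sub_jump_ren (J : jump) : forall r s c,
  sub_jump s c (ren_jump r J) = sub_jump (fun n => s (r Ord n)) (fun n => c (r Cont n)) J.
Proof.
  - destruct t; intros r s c; cbn; rewrite ?sub_term_ren, ?sub_jump_ren,
      ?lift_terms_up, ?lift_ctxs_up; reflexivity.
  - destruct J; intros r s c; cbn; rewrite ?sub_term_ren, ?sub_jump_ren,
      ?lift_terms_up, ?lift_ctxs_up; reflexivity.
Qed.

Lemma ren_term_sub (t : term) : forall r s c, ren_term r (sub_term s c t)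
  = sub_term (fun n => ren_term r (s n)) (fun k => ren_ctx r (c k)) t
with ren_jump_sub (J : jump) : forall r s c, ren_jump r (sub_jump s c J)
  = sub_jump (fun n => ren_term r (s n)) (fun k => ren_ctx r (c k)) J.
Proof.
  - destruct t; intros r s c; cbn; rewrite ?ren_term_sub, ?ren_jump_sub,
      ?ren_lift_terms, ?ren_lift_ctxs; reflexivity.
  - destruct J; intros r s c; cbn; rewrite ?ren_jump_fill, ?ren_term_sub, ?ren_jump_sub,
      ?ren_lift_terms, ?ren_lift_ctxs; reflexivity.
Qed.

Lemma sub_term_id (t : term) : sub_term Var jmp_ctx t = t
with sub_jump_id (J : jump) : sub_jump Var jmp_ctx J = J.
Proof.
  - destruct t; cbn; rewrite ?lift_terms_Var, ?lift_ctxs_jmp_ctx, ?sub_term_id,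
      ?sub_jump_id; reflexivity.
  - destruct J; cbn; rewrite ?lift_terms_Var, ?lift_ctxs_jmp_ctx, ?sub_term_id,
      ?sub_jump_id; reflexivity.
Qed.

Lemma sub_lift_wk_term k s c t :
  sub_term (lift_terms k s) (lift_ctxs k c) (wk_term k t) = wk_term k (sub_term s c t).
Proof. rewrite sub_term_ren, ren_term_sub. now destruct k. Qed.

Lemma sub_scons_wk_term a t : sub_term Var (scons a jmp_ctx) (wk_term Cont t) = t.
Proof. rewrite sub_term_ren. apply sub_term_id. Qed.

Lemma ren_kcons_wk_term k l t : ren_term (kcons k l idr) (wk_term k t) = t.
Proof.
  rewrite ren_term_ren. rewrite <- (ren_term_id t) at 2. f_equal. ext_var.
Qed.

(** * The de Bruijn operations as renamings and substitutions *)

Lemma up_on_kind k f : up k (on_kind k f) = on_kind k (scons 0 (fun n => S (f n))).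
Proof. ext_var. Qed.

Lemma up_Ord_on_Cont f : up Ord (on_kind Cont f) = on_kind Cont f.
Proof. ext_var. Qed.

Lemma up_Cont_on_Ord f : up Cont (on_kind Ord f) = on_kind Ord f.
Proof. ext_var. Qed.

Lemma scons_shift_from c : scons 0 (fun n => S (if c <=? n then S n else n))
  = (fun n => if S c <=? n then S n else n).
Proof. extensionality n. destruct n; simpl; [reflexivity|]. now destruct (c <=? n). Qed.

Lemma shift_t_ren (t : term) : forall c,
  shift_t c t = ren_term (on_kind Ord (fun n => if c <=? n then S n else n)) t
with shift_tj_ren (J : jump) : forall c,
  shift_tj c J = ren_jump (on_kind Ord (fun n => if c <=? n then S n else n)) J.
Proof.
  - destruct t; intro c; simpl; rewrite ?up_on_kind, ?up_Cont_on_Ord, ?scons_shift_from,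
      ?shift_t_ren, ?shift_tj_ren; reflexivity.
  - destruct J; intro c; simpl; rewrite ?up_on_kind, ?scons_shift_from,
      ?shift_t_ren, ?shift_tj_ren; reflexivity.
Qed.

Lemma shift_k_ren (t : term) : forall c,
  shift_k c t = ren_term (on_kind Cont (fun n => if c <=? n then S n else n)) t
with shift_kj_ren (J : jump) : forall c,
  shift_kj c J = ren_jump (on_kind Cont (fun n => if c <=? n then S n else n)) J.
Proof.
  - destruct t; intro c; simpl; rewrite ?up_on_kind, ?up_Ord_on_Cont, ?scons_shift_from,
      ?shift_k_ren, ?shift_kj_ren; reflexivity.
  - destruct J; intro c; simpl; rewrite ?up_Ord_on_Cont,
      ?shift_k_ren, ?shift_kj_ren; reflexivity.
Qed.

Lemma shift_t_0 t : shift_t 0 t = wk_term Ord t.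
Proof. apply shift_t_ren. Qed.

Lemma shift_k_0 t : shift_k 0 t = wk_term Cont t.
Proof. apply shift_k_ren. Qed.

Lemma shift_t_1 t : shift_t 1 t = ren_term (up Ord (shift Ord)) t.
Proof. rewrite shift_t_ren. f_equal. ext_var. Qed.

Lemma shift_tj_1 J : shift_tj 1 J = ren_jump (up Ord (shift Ord)) J.
Proof. rewrite shift_tj_ren. f_equal. ext_var. Qed.

Lemma up_Ord_kcons_Cont l : up Ord (kcons Cont l idr) = kcons Cont l idr.
Proof. ext_var. Qed.

Lemma rename_k_ren (t : term) : forall e l, rename_k e l t
  = ren_term (on_kind Cont (fun k => if k =? e then l else if e <? k then pred k else k)) t
with rename_kj_ren (J : jump) : forall e l, rename_kj e l J
  = ren_jump (on_kind Cont (fun k => if k =? e then l else if e <? k then pred k else k)) J.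
Proof.
  - destruct t; intros e l; simpl; rewrite ?up_Ord_on_Cont, ?rename_k_ren, ?rename_kj_ren;
      try reflexivity.
    do 2 f_equal. rewrite up_on_kind. f_equal.
    extensionality k. destruct k; simpl; [reflexivity|].
    destruct (k =? e); [reflexivity|]. change (S e <? S k) with (e <? k).
    destruct (Nat.ltb_spec e k); lia.
  - destruct J; intros e l; simpl; rewrite ?up_Ord_on_Cont, ?rename_k_ren, ?rename_kj_ren;
      reflexivity.
Qed.

Lemma rename_kj_0 l J : rename_kj 0 l J = ren_jump (kcons Cont l idr) J.
Proof. rewrite rename_kj_ren. f_equal. ext_var. Qed.

Definition subst_at (j : nat) (s : term) (n : nat) : term :=
  if n =? j then s else if j <? n then Var (pred n) else Var n.

Lemma lift_subst_at_Ord j s :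
  lift_terms Ord (subst_at j s) = subst_at (S j) (wk_term Ord s).
Proof.
  extensionality n. unfold lift_terms, subst_at. destruct n; simpl; [reflexivity|].
  destruct (n =? j); [reflexivity|]. change (S j <? S n) with (j <? n).
  destruct (Nat.ltb_spec j n); simpl; f_equal; lia.
Qed.

Lemma lift_subst_at_Cont j s :
  lift_terms Cont (subst_at j s) = subst_at j (wk_term Cont s).
Proof.
  extensionality n. unfold lift_terms, subst_at.
  destruct (n =? j); [reflexivity|]. now destruct (j <? n).
Qed.

Lemma subst_t_sub (t : term) : forall e s,
  subst_t e s t = sub_term (subst_at e s) jmp_ctx t
with subst_tj_sub (J : jump) : forall e s,
  subst_tj e s J = sub_jump (subst_at e s) jmp_ctx J.
Proof.
  - destruct t; intros e s; cbn;
      rewrite ?lift_ctxs_jmp_ctx, ?lift_subst_at_Ord, ?lift_subst_at_Cont, ?shift_t_0,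
        ?shift_k_0, ?subst_t_sub, ?subst_tj_sub; reflexivity.
  - destruct J; intros e s; cbn;
      rewrite ?lift_ctxs_jmp_ctx, ?lift_subst_at_Ord, ?shift_t_0,
        ?subst_t_sub, ?subst_tj_sub; reflexivity.
Qed.

Lemma subst_t_0 s t : subst_t 0 s t = sub_term (scons s Var) jmp_ctx t.
Proof. rewrite subst_t_sub. f_equal. extensionality n. now destruct n. Qed.

Definition where_at (e : nat) (M : term) (k : nat) : ctx :=
  if k =? e then where_ctx k M else jmp_ctx k.

Lemma lift_where_at_Ord e M : lift_ctxs Ord (where_at e M) = where_at e (shift_t 1 M).
Proof.
  extensionality k. unfold lift_ctxs, where_at. rewrite shift_t_1. now destruct (k =? e).
Qed.

Lemma lift_where_at_Cont e M :
  lift_ctxs Cont (where_at e M) = where_at (S e) (shift_k 0 M).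
Proof.
  extensionality k. unfold lift_ctxs, where_at. rewrite shift_k_0.
  destruct k; simpl; [reflexivity|].
  destruct (k =? e); [|reflexivity]. unfold shift. simpl. now rewrite up_Ord_on_Cont.
Qed.

Lemma ssub_t_sub (t : term) : forall e M, ssub_t e M t = sub_term Var (where_at e M) t
with ssub_j_sub (J : jump) : forall e M, ssub_j e M J = sub_jump Var (where_at e M) J.
Proof.
  - destruct t; intros e M; cbn;
      rewrite ?lift_terms_Var, ?lift_where_at_Ord, ?lift_where_at_Cont, ?ssub_t_sub,
        ?ssub_j_sub; reflexivity.
  - destruct J; intros e M; cbn;
      rewrite ?lift_terms_Var, ?lift_where_at_Ord, ?ssub_t_sub, ?ssub_j_sub; [|reflexivity].
    unfold where_at. now destruct (n =? e).
Qed.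

Lemma ssub_j_0 M J :
  ssub_j 0 M J = sub_jump Var (scons (where_ctx 0 M) (fun k => jmp_ctx (S k))) J.
Proof. rewrite ssub_j_sub. f_equal. extensionality k. now destruct k. Qed.

(** * Reduction modulo the congruence *)

Definition red_mod {A} (R E : relation A) : relation A :=
  clos_refl_trans A (union A R (clos_refl_sym_trans A E)).

Lemma red_mod_step {A} (R E : relation A) a b : R a b -> red_mod R E a b.
Proof. intro H. apply rt_step. now left. Qed.

Lemma red_mod_eqv {A} (R E : relation A) a b :
  clos_refl_sym_trans A E a b -> red_mod R E a b.
Proof. intro H. apply rt_step. now right. Qed.

Lemma red_mod_map {A B} (R E : relation A) (R' E' : relation B) (f : A -> B) :
  (forall a b, R a b -> R' (f a) (f b)) -> (forall a b, E a b -> E' (f a) (f b)) ->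
  forall a b, red_mod R E a b -> red_mod R' E' (f a) (f b).
Proof.
  intros HR HE. apply clos_rt_map. intros a b [H|H].
  - now apply red_mod_step, HR.
  - apply red_mod_eqv. revert H. apply clos_rst_map. intros. now apply rst_step, HE.
Qed.

Definition mred : relation term := red_mod step_t ec_t.
Definition mred_jump : relation jump := red_mod step_j ec_j.
Definition cong_jump : relation jump := clos_refl_sym_trans jump ec_j.

Lemma mred_reds M N : mred M N -> reds M N.
Proof.
  apply (clos_rt_map _ _ (fun t => t)). intros a b [H|H]; apply rt_step; [left|now right].
  exists a, b. repeat split; auto; apply rst_refl.
Qed.

Lemma mred_Lam M M' : mred M M' -> mred (Lam M) (Lam M').
Proof. apply red_mod_map; now constructor. Qed.

Lemma mred_App M M' N N' : mred M M' -> mred N N' -> mred (App M N) (App M' N').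
Proof.
  intros HM HN. apply rt_trans with (App M' N).
  - revert HM. apply (red_mod_map _ _ _ _ (fun t => App t N)); now constructor.
  - revert HN. apply red_mod_map; now constructor.
Qed.

Lemma mred_Where L L' M M' : mred L L' -> mred M M' -> mred (Where L M) (Where L' M').
Proof.
  intros HL HM. apply rt_trans with (Where L' M).
  - revert HL. apply (red_mod_map _ _ _ _ (fun t => Where t M)); now constructor.
  - revert HM. apply red_mod_map; now constructor.
Qed.

Lemma mred_Mu J J' : mred_jump J J' -> mred (Mu J) (Mu J').
Proof. apply red_mod_map; now constructor. Qed.

Lemma mred_Jmp k M M' : mred M M' -> mred_jump (Jmp k M) (Jmp k M').
Proof. apply red_mod_map; now constructor. Qed.

Lemma mred_JWhere J J' M M' :
  mred_jump J J' -> mred M M' -> mred_jump (JWhere J M) (JWhere J' M').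
Proof.
  intros HJ HM. apply rt_trans with (JWhere J' M).
  - revert HJ. apply (red_mod_map _ _ _ _ (fun I => JWhere I M)); now constructor.
  - revert HM. apply red_mod_map; now constructor.
Qed.

Lemma cong_Mu J J' : cong_jump J J' -> cong (Mu J) (Mu J').
Proof. apply clos_rst_map. intros. apply rst_step. now constructor. Qed.

Lemma cong_Where L L' M : cong L L' -> cong (Where L M) (Where L' M).
Proof.
  apply (clos_rst_map _ _ (fun t => Where t M)). intros. apply rst_step. now constructor.
Qed.

Lemma cong_JWhere J J' M : cong_jump J J' -> cong_jump (JWhere J M) (JWhere J' M).
Proof.
  apply (clos_rst_map _ _ (fun I => JWhere I M)). intros. apply rst_step. now constructor.
Qed.

Lemma is_value_ren r t : is_value (ren_term r t) = is_value t.
Proof. now destruct t. Qed.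

Lemma ren_shift_t_0 r t : ren_term (up Ord r) (shift_t 0 t) = shift_t 0 (ren_term r t).
Proof. rewrite !shift_t_0. apply ren_up_wk_term. Qed.

Lemma ren_shift_k_0 r t : ren_term (up Cont r) (shift_k 0 t) = shift_k 0 (ren_term r t).
Proof. rewrite !shift_k_0. apply ren_up_wk_term. Qed.

Lemma ren_shift_t_1 r t :
  ren_term (up Ord (up Ord r)) (shift_t 1 t) = shift_t 1 (ren_term (up Ord r) t).
Proof. rewrite !shift_t_1, !ren_term_ren. f_equal. ext_var. Qed.

Lemma ren_shift_tj_1 r J :
  ren_jump (up Ord (up Ord r)) (shift_tj 1 J) = shift_tj 1 (ren_jump (up Ord r) J).
Proof. rewrite !shift_tj_1, !ren_jump_ren. f_equal. ext_var. Qed.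

Lemma ren_subst_t_0 r s t :
  ren_term r (subst_t 0 s t) = subst_t 0 (ren_term r s) (ren_term (up Ord r) t).
Proof.
  rewrite !subst_t_0, ren_term_sub, sub_term_ren. f_equal. extensionality n. now destruct n.
Qed.

Lemma ren_ssub_j_0 r M J : ren_jump (up Cont r) (ssub_j 0 (shift_k 0 M) J)
  = ssub_j 0 (shift_k 0 (ren_term (up Ord r) M)) (ren_jump (up Cont r) J).
Proof.
  rewrite !ssub_j_0, ren_jump_sub, sub_jump_ren. f_equal. extensionality k.
  destruct k; [|reflexivity]. simpl. now rewrite up_comm, ren_shift_k_0.
Qed.

Lemma ren_rename_kj_0 r l J :
  ren_jump r (rename_kj 0 l J) = rename_kj 0 (r Cont l) (ren_jump (up Cont r) J).
Proof. rewrite !rename_kj_0, !ren_jump_ren. f_equal. ext_var. Qed.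

Lemma step_t_ren t t' (H : step_t t t') : forall r, step_t (ren_term r t) (ren_term r t')
with step_j_ren J J' (H : step_j J J') : forall r, step_j (ren_jump r J) (ren_jump r J').
Proof.
  - destruct H; intro r; simpl;
      rewrite ?ren_shift_t_0, ?ren_shift_k_0, ?ren_subst_t_0, ?ren_ssub_j_0;
      solve [constructor; rewrite ?is_value_ren; auto].
  - destruct H; intro r; simpl; rewrite ?ren_rename_kj_0; constructor; auto.
Qed.

Lemma ec_t_ren t t' (H : ec_t t t') : forall r, ec_t (ren_term r t) (ren_term r t')
with ec_j_ren J J' (H : ec_j J J') : forall r, ec_j (ren_jump r J) (ren_jump r J').
Proof.
  - destruct H as [? ? []| | | | | |]; intro r; simpl; try solve [constructor; auto].
    + rewrite ren_shift_t_1. apply ec_ax, E1.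
    + rewrite up_comm, ren_shift_k_0. apply ec_ax, E2.
  - destruct H as [? ? []| | |]; intro r; simpl; try solve [constructor; auto].
    + rewrite ren_shift_tj_1. apply ecj_ax, E1j.
    + apply ecj_ax, E3.
Qed.

Lemma mred_ren r t t' : mred t t' -> mred (ren_term r t) (ren_term r t').
Proof. apply red_mod_map; intros; [now apply step_t_ren|now apply ec_t_ren]. Qed.

Lemma cong_ren r t t' : cong t t' -> cong (ren_term r t) (ren_term r t').
Proof. apply clos_rst_map. intros. now apply rst_step, ec_t_ren. Qed.

(** * Free continuation variables *)

Fixpoint all_conts (P : nat -> Prop) (t : term) : Prop :=
  match t with
  | Var _ => True
  | Lam M => all_conts P M
  | App M N | Where M N => all_conts P M /\ all_conts P N
  | Mu J => all_conts_jump (scons True P) J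
  end
with all_conts_jump (P : nat -> Prop) (J : jump) : Prop :=
  match J with
  | Jmp k M => P k /\ all_conts P M
  | JWhere J M => all_conts_jump P J /\ all_conts P M
  end.

Definition all_conts_ctx (P : nat -> Prop) (a : ctx) : Prop :=
  match a with
  | jmp_ctx l => P l
  | where_ctx l L => P l /\ all_conts P L
  end.

Lemma scons_True_up_Cont P r : (fun k => scons True P (up Cont r Cont k))
  = scons True (fun k => P (r Cont k)).
Proof. extensionality k. now destruct k. Qed.

Lemma all_conts_ren (t : term) : forall P r,
  all_conts P (ren_term r t) = all_conts (fun k => P (r Cont k)) t
with all_conts_jump_ren (J : jump) : forall P r,
  all_conts_jump P (ren_jump r J) = all_conts_jump (fun k => P (r Cont k)) J.
Proof.
  - destruct t; intros P r; simpl;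
      rewrite ?all_conts_ren, ?all_conts_jump_ren, ?scons_True_up_Cont; reflexivity.
  - destruct J; intros P r; simpl; rewrite ?all_conts_ren, ?all_conts_jump_ren; reflexivity.
Qed.

Lemma all_conts_ctx_ren P r a :
  all_conts_ctx P (ren_ctx r a) = all_conts_ctx (fun k => P (r Cont k)) a.
Proof. destruct a; simpl; [reflexivity|]. now rewrite all_conts_ren. Qed.

Lemma scons_True_mono (P Q : nat -> Prop) : (forall k, P k -> Q k) ->
  forall k, scons True P k -> scons True Q k.
Proof. intros H [|k]; simpl; auto. Qed.

Lemma all_conts_mono (t : term) : forall P Q : nat -> Prop,
  (forall k, P k -> Q k) -> all_conts P t -> all_conts Q t
with all_conts_jump_mono (J : jump) : forall P Q : nat -> Prop,
  (forall k, P k -> Q k) -> all_conts_jump P J -> all_conts_jump Q J.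
Proof.
  - destruct t; intros P Q H; simpl; intuition eauto using scons_True_mono.
  - destruct J; intros P Q H; simpl; intuition eauto.
Qed.

Lemma all_conts_intro (t : term) : forall P : nat -> Prop, (forall k, P k) -> all_conts P t
with all_conts_jump_intro (J : jump) : forall P : nat -> Prop,
  (forall k, P k) -> all_conts_jump P J.
Proof.
  - destruct t; intros P H; simpl; auto.
    apply all_conts_jump_intro. intros [|k]; simpl; auto.
  - destruct J; intros P H; simpl; auto.
Qed.

Definition agree_on (P : nat -> Prop) (r r' : renaming) : Prop :=
  (forall n, r Ord n = r' Ord n) /\ (forall k, P k -> r Cont k = r' Cont k).

Lemma agree_on_up_Ord P r r' : agree_on P r r' -> agree_on P (up Ord r) (up Ord r').
Proof. intros [HO HC]. split; [intros [|n]; simpl; auto|exact HC]. Qed.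

Lemma agree_on_up_Cont P r r' :
  agree_on P r r' -> agree_on (scons True P) (up Cont r) (up Cont r').
Proof. intros [HO HC]. split; [exact HO|intros [|k]; simpl; auto]. Qed.

Lemma ren_term_agree (t : term) : forall P r r', agree_on P r r' ->
  all_conts P t -> ren_term r t = ren_term r' t
with ren_jump_agree (J : jump) : forall P r r', agree_on P r r' ->
  all_conts_jump P J -> ren_jump r J = ren_jump r' J.
Proof.
  - destruct t; intros P r r' H Ht; simpl in *; f_equal;
      try apply H; intuition eauto using agree_on_up_Ord, agree_on_up_Cont.
  - destruct J; intros P r r' H HJ; simpl in *; f_equal;
      try apply H; intuition eauto using agree_on_up_Ord.
Qed.

Lemma all_conts_fill P a t :
  all_conts_ctx P a -> all_conts P t -> all_conts_jump P (fill a t).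
Proof. destruct a; simpl; tauto. Qed.

Definition maps_conts (P Q : nat -> Prop) (s : nat -> term) (c : nat -> ctx) : Prop :=
  (forall n, all_conts Q (s n)) /\ (forall k, P k -> all_conts_ctx Q (c k)).

Lemma maps_conts_lift_Ord P Q s c :
  maps_conts P Q s c -> maps_conts P Q (lift_terms Ord s) (lift_ctxs Ord c).
Proof.
  intros [Hs Hc]. split.
  - intros [|n]; [exact I|]. unfold lift_terms. simpl. rewrite all_conts_ren. apply Hs.
  - intros k Hk. unfold lift_ctxs. rewrite all_conts_ctx_ren. now apply Hc.
Qed.

Lemma maps_conts_lift_Cont P Q s c : maps_conts P Q s c ->
  maps_conts (scons True P) (scons True Q) (lift_terms Cont s) (lift_ctxs Cont c).
Proof.
  intros [Hs Hc]. split.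
  - intro n. unfold lift_terms. rewrite all_conts_ren. apply Hs.
  - intros [|k] Hk; [exact I|]. unfold lift_ctxs. simpl.
    rewrite all_conts_ctx_ren. now apply Hc.
Qed.

Lemma all_conts_sub (t : term) : forall P Q s c, maps_conts P Q s c ->
  all_conts P t -> all_conts Q (sub_term s c t)
with all_conts_jump_sub (J : jump) : forall P Q s c, maps_conts P Q s c ->
  all_conts_jump P J -> all_conts_jump Q (sub_jump s c J).
Proof.
  - destruct t; intros P Q s c H Ht; cbn in *; try apply H;
      intuition eauto using maps_conts_lift_Ord, maps_conts_lift_Cont.
  - destruct J; intros P Q s c H [H1 H2]; cbn.
    + apply all_conts_fill; [now apply H|eauto].
    + split; eauto using maps_conts_lift_Ord.
Qed.

Lemma step_t_all_conts t t' (H : step_t t t') : forall P, all_conts P t -> all_conts P t'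
with step_j_all_conts J J' (H : step_j J J') : forall P,
  all_conts_jump P J -> all_conts_jump P J'.
Proof.
  - destruct H; intros P Ht; simpl in *; rewrite ?shift_t_0, ?shift_k_0 in *;
      rewrite ?all_conts_ren in *; simpl in *; intuition eauto.
    + rewrite subst_t_0. eapply all_conts_sub; [|eassumption].
      split; [intros [|n]|]; simpl; auto.
    + rewrite ssub_j_0. eapply all_conts_jump_sub; [|eassumption].
      split; [|intros [|k]]; simpl; auto. now rewrite all_conts_ren.
  - destruct H; intros P [HJ Ht]; simpl in *; [|eauto ..].
    rewrite rename_kj_0, all_conts_jump_ren. revert Ht. apply all_conts_jump_mono.
    intros [|k]; simpl; auto.
Qed.

Lemma ec_t_all_conts t t' (H : ec_t t t') : forall P, all_conts P t <-> all_conts P t'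
with ec_j_all_conts J J' (H : ec_j J J') : forall P,
  all_conts_jump P J <-> all_conts_jump P J'.
Proof.
  - destruct H as [? ? []| | | | | |]; intro P; simpl;
      auto using and_iff_compat_l, and_iff_compat_r.
    + rewrite shift_t_1, all_conts_ren. simpl. tauto.
    + rewrite shift_k_0, all_conts_ren. reflexivity.
  - destruct H as [? ? []| | |]; intro P; simpl;
      auto using and_iff_compat_l, and_iff_compat_r.
    + rewrite shift_tj_1, all_conts_jump_ren. simpl. tauto.
    + tauto.
Qed.

Lemma cong_all_conts P t t' : cong t t' -> all_conts P t <-> all_conts P t'.
Proof. induction 1; [now apply ec_t_all_conts|tauto|tauto|tauto]. Qed.

(** * Contraction of mu *)

Lemma term_eq_dec (t u : term) : {t = u} + {t <> u}
with jump_eq_dec (I J : jump) : {I = J} + {I <> J}.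
Proof.
  - decide equality. apply Nat.eq_dec.
  - decide equality. apply Nat.eq_dec.
Defined.

Definition fresh_cont (t : term) : Prop := all_conts (fun k => k <> 0) t.
Definition lower_cont (t : term) : term := ren_term (on_kind Cont pred) t.

Lemma fresh_cont_wk t : fresh_cont (wk_term Cont t).
Proof. unfold fresh_cont. rewrite all_conts_ren. apply all_conts_intro. discriminate. Qed.

Lemma lower_cont_wk t : lower_cont (wk_term Cont t) = t.
Proof.
  unfold lower_cont. rewrite ren_term_ren.
  rewrite <- (ren_term_id t) at 2. f_equal. ext_var.
Qed.

Lemma wk_lower_cont t : fresh_cont t -> wk_term Cont (lower_cont t) = t.
Proof.
  intro H. unfold lower_cont. rewrite ren_term_ren. rewrite <- (ren_term_id t) at 2.
  eapply ren_term_agree; [|exact H]. split; [reflexivity|].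
  intros [|k] Hk; [contradiction|reflexivity].
Qed.

Lemma fresh_cont_dec t : {fresh_cont t} + {~ fresh_cont t}.
Proof.
  destruct (term_eq_dec (wk_term Cont (lower_cont t)) t) as [E|E].
  - left. rewrite <- E. apply fresh_cont_wk.
  - right. intro H. now apply E, wk_lower_cont.
Qed.

Lemma cong_fresh_cont t t' : cong t t' -> fresh_cont t -> fresh_cont t'.
Proof. intros H F. now apply (cong_all_conts _ _ _ H). Qed.

Fixpoint target (J : jump) : nat :=
  match J with Jmp k _ => k | JWhere J _ => target J end.
Fixpoint body (J : jump) : term :=
  match J with Jmp _ M => M | JWhere J M => Where (body J) M end.

Lemma cong_jump_Jmp_target_body J : cong_jump J (Jmp (target J) (body J)).
Proof.
  induction J as [k M|J IH M]; simpl; [apply rst_refl|].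
  apply rst_trans with (JWhere (Jmp (target J) (body J)) M).
  - now apply cong_JWhere.
  - apply rst_sym, rst_step, ecj_ax, E3.
Qed.

Lemma target_ren J : forall r, target (ren_jump r J) = r Cont (target J).
Proof. induction J as [k M|J IH M]; intro r; simpl; [reflexivity|now rewrite IH]. Qed.

Lemma body_ren J : forall r, body (ren_jump r J) = ren_term r (body J).
Proof. induction J as [k M|J IH M]; intro r; simpl; [reflexivity|now rewrite IH]. Qed.

Definition mu_eta (J : jump) : term :=
  match target J with
  | 0 => if fresh_cont_dec (body J) then lower_cont (body J) else Mu J
  | S _ => Mu J
  end.

Variant mu_eta_spec (J : jump) : term -> Prop :=
| mu_eta_contract : target J = 0 -> fresh_cont (body J) ->
    mu_eta_spec J (lower_cont (body J))
| mu_eta_stuck : (target J = 0 -> ~ fresh_cont (body J)) -> mu_eta_spec J (Mu J).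

Lemma mu_etaP J : mu_eta_spec J (mu_eta J).
Proof.
  unfold mu_eta. destruct (target J) eqn:E.
  - destruct (fresh_cont_dec (body J)); now constructor.
  - constructor. now rewrite E.
Qed.

Lemma mu_eta_lower_cont J :
  target J = 0 -> fresh_cont (body J) -> mu_eta J = lower_cont (body J).
Proof. intros H F. destruct (mu_etaP J) as [_ _|N]; [reflexivity|now destruct (N H)]. Qed.

Lemma mu_eta_eq J t : target J = 0 -> body J = wk_term Cont t -> mu_eta J = t.
Proof.
  intros H E. rewrite mu_eta_lower_cont, E by (rewrite ?E; trivial using fresh_cont_wk).
  apply lower_cont_wk.
Qed.

Lemma mred_Mu_mu_eta J : mred (Mu J) (mu_eta J).
Proof.
  destruct (mu_etaP J) as [H F|_]; [|apply rt_refl].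
  apply rt_trans with (Mu (Jmp 0 (wk_term Cont (lower_cont (body J))))).
  - apply red_mod_eqv, cong_Mu. rewrite wk_lower_cont, <- H by assumption.
    apply cong_jump_Jmp_target_body.
  - rewrite <- shift_k_0. apply red_mod_step, r_mu_jmp.
Qed.

Lemma mu_eta_ren r J : mu_eta (ren_jump (up Cont r) J) = ren_term r (mu_eta J).
Proof.
  destruct (mu_etaP J) as [H F|N].
  - apply mu_eta_eq; rewrite ?target_ren, ?body_ren; [now rewrite H|].
    rewrite <- (wk_lower_cont (body J)) at 1 by assumption. apply ren_up_wk_term.
  - destruct (mu_etaP (ren_jump (up Cont r) J)) as [H F|_]; [exfalso|reflexivity].
    rewrite target_ren in H. rewrite body_ren in F. unfold fresh_cont in *.
    rewrite all_conts_ren in F. apply N.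
    + now destruct (target J).
    + revert F. apply all_conts_mono. intros [|k]; simpl; auto.
Qed.

Lemma step_j_target_body J J' : step_j J J' ->
  (target J' = target J /\ step_t (body J) (body J')) \/
  (exists I, cong (body J) (Mu I) /\ J' = rename_kj 0 (target J) I).
Proof.
  induction 1 as [l J|k M M' H|J J' M _ IH|J M M' H]; simpl.
  - right. exists J. split; [apply rst_refl|reflexivity].
  - now left.
  - destruct IH as [[E S]|[I [C ->]]].
    + left. split; [assumption|now constructor].
    + right. exists (JWhere I (shift_k 0 M)). split.
      * apply rst_trans with (Where (Mu I) M); [now apply cong_Where|].
        apply rst_step, ec_ax, E2.
      * rewrite !rename_kj_0. simpl.
        now rewrite up_Ord_kcons_Cont, shift_k_0, ren_kcons_wk_term.
  - left. split; [reflexivity|now constructor].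
Qed.

Lemma ec_j_target_body J J' : ec_j J J' -> target J' = target J /\ cong (body J) (body J').
Proof.
  induction 1 as [? ? [J M N|k L M]|k M M' H|J J' M _ [E C]|J M M' H]; simpl.
  - rewrite shift_tj_1, target_ren, body_ren, <- shift_t_1. split; [reflexivity|].
    apply rst_step, ec_ax, E1.
  - split; [reflexivity|apply rst_refl].
  - split; [reflexivity|now apply rst_step].
  - split; [assumption|now apply cong_Where].
  - split; [reflexivity|]. now apply rst_step, ec_wherer.
Qed.

Lemma cong_jump_target_body J J' : cong_jump J J' ->
  target J' = target J /\ cong (body J) (body J').
Proof.
  induction 1 as [J J' H|J|J J' _ [E C]|J J' J'' _ [E C] _ [E' C']].
  - now apply ec_j_target_body.
  - split; [reflexivity|apply rst_refl].
  - split; [auto|now apply rst_sym].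
  - split; [congruence|eapply rst_trans; eassumption].
Qed.

(* Contracting [mu k.[k]M] to [M] loses nothing: the jump [[k]M] can only evolve
   by reducing [M], or by becoming [J] when [M] is [mu k.J]. *)
Lemma step_j_mu_eta J J' : step_j J J' -> mred (mu_eta J) (mu_eta J').
Proof.
  intro H. destruct (mu_etaP J) as [T F|_].
  2: { apply rt_trans with (Mu J'); [|apply mred_Mu_mu_eta].
       now apply mred_Mu, red_mod_step. }
  apply step_j_target_body in H as [[E S]|[I [C ->]]].
  - rewrite (mu_eta_lower_cont J') by (congruence || eapply step_t_all_conts; eassumption).
    now apply mred_ren, red_mod_step.
  - apply rt_trans with (Mu (rename_kj 0 (target J) I)); [|apply mred_Mu_mu_eta].
    apply red_mod_eqv. eapply rst_trans; [apply cong_ren, C|].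
    apply (cong_fresh_cont _ _ C) in F. rewrite T, rename_kj_0. simpl.
    erewrite ren_jump_agree; [apply rst_refl| |exact F].
    split; [now intros [|n]|]. intros [|[|k]] Hk; [reflexivity|now destruct Hk|reflexivity].
Qed.

Lemma cong_jump_mu_eta J J' : cong_jump J J' -> mred (mu_eta J) (mu_eta J').
Proof.
  intro H. destruct (mu_etaP J) as [T F|_].
  - apply cong_jump_target_body in H as [E C].
    rewrite (mu_eta_lower_cont J') by (congruence || eapply cong_fresh_cont; eassumption).
    now apply red_mod_eqv, cong_ren.
  - apply rt_trans with (Mu J'); [now apply mred_Mu, red_mod_eqv|apply mred_Mu_mu_eta].
Qed.

Lemma mred_mu_eta J J' : mred_jump J J' -> mred (mu_eta J) (mu_eta J').
Proof.
  apply clos_rt_map. intros I I' [H|H];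
    [now apply step_j_mu_eta|now apply cong_jump_mu_eta].
Qed.

Lemma target_body_sub_jump J : forall s c l, c (target J) = jmp_ctx l ->
  target (sub_jump s c J) = l /\ body (sub_jump s c J) = sub_term s c (body J).
Proof.
  induction J as [k M|J IH M]; intros s c l H; cbn in *.
  - now rewrite H.
  - destruct (IH (lift_terms Ord s) (lift_ctxs Ord c) l) as [-> ->]; [|now split].
    unfold lift_ctxs. now rewrite H.
Qed.

Lemma mred_sub_mu_eta s c J : mred (sub_term s c (mu_eta J))
  (mu_eta (sub_jump (lift_terms Cont s) (lift_ctxs Cont c) J)).
Proof.
  destruct (mu_etaP J) as [T F|_]; [|apply mred_Mu_mu_eta].
  destruct (target_body_sub_jump J (lift_terms Cont s) (lift_ctxs Cont c) 0) as [T' B];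
    [now rewrite T|].
  rewrite (mu_eta_eq _ (sub_term s c (lower_cont (body J)))); [apply rt_refl|exact T'|].
  rewrite B, <- (wk_lower_cont (body J)) at 1 by assumption. apply sub_lift_wk_term.
Qed.

Lemma cong_fill_Where a L t :
  cong_jump (fill a (Where L t)) (JWhere (fill (wk_ctx Ord a) L) t).
Proof.
  destruct a as [l|l L']; cbn; [apply rst_step, ecj_ax, E3|].
  apply rst_trans with (Jmp l (Where (Where (shift_t 1 L') L) t)).
  - apply rst_step, ecj_jmp, ec_ax, E1.
  - rewrite shift_t_1. apply rst_step, ecj_ax, E3.
Qed.

Lemma cong_fill_sub_body J : forall s c,
  cong_jump (fill (c (target J)) (sub_term s c (body J))) (sub_jump s c J).
Proof.
  induction J as [k M|J IH M]; intros s c; cbn; [apply rst_refl|].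
  eapply rst_trans; [apply cong_fill_Where|]. apply cong_JWhere, (IH _ (lift_ctxs Ord c)).
Qed.

(** * CPS translation *)

Definition ret (v : tm) : tm := abs Cont (app Ord (var Cont 0) (wk Cont v)).

(* Ordinary variable 0 of [p] stands for the result of [q]. *)
Definition bind (q p : tm) : tm :=
  abs Cont (app Cont (wk Cont q) (abs Ord (app Cont (wk Cont p) (var Cont 0)))).

Arguments ret : simpl never.
Arguments bind : simpl never.

Definition call (is_val : bool) (v w q : tm) : tm :=
  if is_val then app Ord v w else bind q (app Ord (wk Ord v) (var Ord 0)).

Arguments call : simpl never.

(* Values in applications are not let-bound, as the source cannot expand [V W] to
   [(x W where x := V)]. [cps_val] is only meaningful on values. *)
Fixpoint cps (t : term) : tm :=
  match t with
  | Var n => ret (var Ord n)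
  | Lam M => ret (abs Ord (cps M))
  | App M N =>
      if is_value M then call (is_value N) (cps_val M) (cps_val N) (cps N)
      else bind (cps M)
        (call (is_value N) (var Ord 0) (wk Ord (cps_val N)) (wk Ord (cps N)))
  | Where L M => bind (cps M) (cps L)
  | Mu J => abs Cont (cps_jump J)
  end
with cps_val (t : term) : tm :=
  match t with
  | Var n => var Ord n
  | Lam M => abs Ord (cps M)
  | _ => abs Ord (var Ord 0)
  end
with cps_jump (J : jump) : tm :=
  match J with
  | Jmp k M => app Cont (cps M) (var Cont k)
  | JWhere J M => app Cont (cps M) (abs Ord (cps_jump J))
  end.

Lemma cps_value t : is_value t = true -> cps t = ret (cps_val t).
Proof. destruct t; simpl; intro; try discriminate; reflexivity. Qed.

Lemma ren_ret r v : ren r (ret v) = ret (ren r v).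
Proof. unfold ret. simpl. now rewrite ren_up_wk. Qed.

Lemma ren_bind r q p : ren r (bind q p) = bind (ren r q) (ren (up Ord r) p).
Proof. unfold bind. simpl. now rewrite ren_up_wk, up_comm, ren_up_wk. Qed.

Lemma ren_call r b v w q : ren r (call b v w q) = call b (ren r v) (ren r w) (ren r q).
Proof.
  destruct b; [reflexivity|]. unfold call. rewrite ren_bind. simpl. now rewrite ren_up_wk.
Qed.

Lemma cps_ren (t : term) : forall r, cps (ren_term r t) = ren r (cps t)
with cps_val_ren (t : term) : forall r, cps_val (ren_term r t) = ren r (cps_val t)
with cps_jump_ren (J : jump) : forall r, cps_jump (ren_jump r J) = ren r (cps_jump J).
Proof.
  - destruct t as [n|M|M N|L M|J]; intro r; cbn.
    + now rewrite ren_ret.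
    + now rewrite ren_ret, cps_ren.
    + rewrite !is_value_ren, !cps_ren, !cps_val_ren.
      destruct (is_value M); [now rewrite ren_call|].
      now rewrite ren_bind, ren_call, !ren_up_wk.
    + now rewrite ren_bind, !cps_ren.
    + now rewrite cps_jump_ren.
  - destruct t as [n|M|M N|L M|J]; intro r; cbn; rewrite ?cps_ren; reflexivity.
  - destruct J as [k M|J M]; intro r; cbn; rewrite ?cps_ren, ?cps_jump_ren; reflexivity.
Qed.

Lemma sub_ret s v : sub s (ret v) = ret (sub s v).
Proof. unfold ret. simpl. now rewrite sub_lift_wk. Qed.

Lemma lift_comm k k' s : lift k (lift k' s) = lift k' (lift k s).
Proof. ext_var; rewrite !ren_ren; f_equal; ext_var. Qed.

Lemma sub_bind s q p : sub s (bind q p) = bind (sub s q) (sub (lift Ord s) p).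
Proof. unfold bind. simpl. now rewrite sub_lift_wk, (lift_comm Ord), sub_lift_wk. Qed.

Lemma conv_ret v v' : conv v v' -> conv (ret v) (ret v').
Proof. intro H. apply conv_abs, conv_app; [apply rst_refl|now apply conv_ren]. Qed.

Lemma conv_bind q q' p p' : conv q q' -> conv p p' -> conv (bind q p) (bind q' p').
Proof.
  intros Hq Hp. apply conv_abs, conv_app; [now apply conv_ren|].
  apply conv_abs, conv_app; [now apply conv_ren|apply rst_refl].
Qed.

Lemma conv_app_ret v K : conv (app Cont (ret v) K) (app Ord K v).
Proof.
  eapply rst_trans; [apply conv_beta|]. simpl. rewrite sub_inst_wk. apply rst_refl.
Qed.

Lemma conv_app_bind q p K :
  conv (app Cont (bind q p) K) (app Cont q (abs Ord (app Cont p (wk Ord K)))).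
Proof.
  eapply rst_trans; [apply conv_beta|]. simpl. rewrite sub_inst_wk.
  apply clos_rst_eq. do 3 f_equal.
  rewrite sub_ren. rewrite <- (sub_id p) at 2. f_equal. ext_var.
Qed.

Lemma conv_bind_ret v p : conv (bind (ret v) p) (sub (inst Ord v) p).
Proof.
  eapply rst_trans; [|apply (conv_eta Cont)]. apply conv_abs.
  rewrite ren_ret. eapply rst_trans; [apply conv_app_ret|].
  eapply rst_trans; [apply conv_beta|]. simpl. apply clos_rst_eq.
  unfold eta_body. f_equal. rewrite sub_ren, ren_sub. f_equal. ext_var.
Qed.

Lemma conv_bind_ret_var q : conv (bind q (ret (var Ord 0))) q.
Proof.
  eapply rst_trans; [|apply (conv_eta Cont)]. apply conv_abs, conv_app; [apply rst_refl|].
  rewrite ren_ret.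
  eapply rst_trans; [apply conv_abs, conv_app_ret|]. apply (conv_eta Ord (var Cont 0)).
Qed.

Lemma conv_bind_assoc r q p :
  conv (bind (bind r q) p) (bind r (bind q (ren (up Ord (shift Ord)) p))).
Proof.
  apply conv_abs. rewrite ren_bind.
  eapply rst_trans; [apply conv_app_bind|].
  apply conv_app; [apply rst_refl|]. apply conv_abs, rst_sym.
  rewrite ren_bind. eapply rst_trans; [apply conv_app_bind|].
  apply clos_rst_eq. simpl. rewrite !ren_ren. do 4 f_equal; f_equal; ext_var.
Qed.

Lemma conv_bind_abs q j :
  conv (bind q (abs Cont j)) (abs Cont (app Cont (wk Cont q) (abs Ord j))).
Proof.
  apply conv_abs, conv_app; [apply rst_refl|]. apply conv_abs, conv_app_wk_abs.
Qed.

Lemma conv_call b v w q : (b = true -> q = ret w) ->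
  conv (call b v w q) (bind q (app Ord (wk Ord v) (var Ord 0))).
Proof.
  destruct b; intro E; [|apply rst_refl]. rewrite E by reflexivity. apply rst_sym.
  eapply rst_trans; [apply conv_bind_ret|]. simpl. rewrite sub_inst_wk. apply rst_refl.
Qed.

(* The right-hand side does not depend on which of [M] and [N] are values: it remains valid
   when a reduction turns one of them into a value. *)
Lemma conv_cps_App M N : conv (cps (App M N))
  (bind (cps M) (bind (wk Ord (cps N)) (app Ord (var Ord 1) (var Ord 0)))).
Proof.
  simpl. destruct (is_value M) eqn:E.
  - eapply rst_trans; [apply conv_call; apply cps_value|]. apply rst_sym.
    rewrite (cps_value M) by assumption.
    eapply rst_trans; [apply conv_bind_ret|]. rewrite sub_bind, sub_inst_wk. apply rst_refl.
  - apply conv_bind; [apply rst_refl|]. apply conv_call.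
    intro EN. rewrite cps_value by assumption. apply ren_ret.
Qed.

Lemma conv_cps_App_congr M M' N N' : conv (cps M) (cps M') -> conv (cps N) (cps N') ->
  conv (cps (App M N)) (cps (App M' N')).
Proof.
  intros HM HN. eapply rst_trans; [apply conv_cps_App|].
  eapply rst_trans; [|apply rst_sym, conv_cps_App].
  apply conv_bind; [assumption|]. apply conv_bind; [now apply conv_ren|apply rst_refl].
Qed.

(** * Translation of substitutions *)

Definition cps_ctx (a : ctx) : tm :=
  match a with
  | jmp_ctx l => var Cont l
  | where_ctx l L => abs Ord (app Cont (cps L) (var Cont l))
  end.

Definition cps_env (s : nat -> term) (c : nat -> ctx) : subst := fun k n =>
  match k with Ord => cps_val (s n) | Cont => cps_ctx (c n) end.

Lemma cps_ctx_ren r a : cps_ctx (ren_ctx r a) = ren r (cps_ctx a).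
Proof. destruct a; simpl; [reflexivity|]. now rewrite cps_ren. Qed.

Lemma cps_env_lift k s c :
  cps_env (lift_terms k s) (lift_ctxs k c) = lift k (cps_env s c).
Proof.
  ext_var; unfold lift_terms, lift_ctxs; simpl;
    rewrite ?cps_val_ren, ?cps_ctx_ren; reflexivity.
Qed.

Lemma is_value_lift_terms k s : (forall n, is_value (s n) = true) ->
  forall n, is_value (lift_terms k s n) = true.
Proof.
  intros H n. destruct k; [destruct n; [reflexivity|]|]; unfold lift_terms; simpl;
    now rewrite is_value_ren.
Qed.

Lemma conv_cps_fill a t : conv (cps_jump (fill a t)) (app Cont (cps t) (cps_ctx a)).
Proof. destruct a; [apply rst_refl|apply conv_app_bind]. Qed.

Lemma conv_cps_sub (t : term) : forall s c, (forall n, is_value (s n) = true) ->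
  conv (cps (sub_term s c t)) (sub (cps_env s c) (cps t))
with conv_cps_sub_jump (J : jump) : forall s c, (forall n, is_value (s n) = true) ->
  conv (cps_jump (sub_jump s c J)) (sub (cps_env s c) (cps_jump J)).
Proof.
  - destruct t as [n|M|M N|L M|J]; intros s c H; cbn [sub_term].
    + rewrite cps_value by apply H. cbn. rewrite sub_ret. apply rst_refl.
    + cbn. rewrite sub_ret. cbn. rewrite <- cps_env_lift.
      apply conv_ret, conv_abs, conv_cps_sub. now apply is_value_lift_terms.
    + apply rst_trans with (sub (cps_env s c)
        (bind (cps M) (bind (wk Ord (cps N)) (app Ord (var Ord 1) (var Ord 0)))));
        [|apply conv_sub, rst_sym, conv_cps_App].
      eapply rst_trans; [apply conv_cps_App|]. rewrite !sub_bind, sub_lift_wk.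
      apply conv_bind; [now apply conv_cps_sub|].
      apply conv_bind; [now apply conv_ren, conv_cps_sub|apply rst_refl].
    + cbn. rewrite sub_bind, <- cps_env_lift.
      apply conv_bind; apply conv_cps_sub; auto using is_value_lift_terms.
    + cbn. rewrite <- cps_env_lift.
      apply conv_abs, conv_cps_sub_jump. now apply is_value_lift_terms.
  - destruct J as [k M|J M]; intros s c H; cbn.
    + eapply rst_trans; [apply conv_cps_fill|].
      apply conv_app; [now apply conv_cps_sub|apply rst_refl].
    + rewrite <- cps_env_lift. apply conv_app; [now apply conv_cps_sub|].
      apply conv_abs, conv_cps_sub_jump. now apply is_value_lift_terms.
Qed.

(** * Source equations are beta-eta conversions *)

Lemma conv_cps_subst_t M V : is_value V = true ->
  conv (cps (subst_t 0 V M)) (sub (inst Ord (cps_val V)) (cps M)).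
Proof.
  intro H. rewrite subst_t_0.
  eapply rst_trans; [apply conv_cps_sub; intros [|n]; trivial|].
  apply clos_rst_eq. f_equal. ext_var.
Qed.

Lemma conv_cps_Where_value M V : is_value V = true ->
  conv (cps (Where M V)) (sub (inst Ord (cps_val V)) (cps M)).
Proof. intro H. simpl. rewrite (cps_value V) by assumption. apply conv_bind_ret. Qed.

Lemma conv_cps_Where_Mu M J :
  conv (cps (Where M (Mu J))) (cps (Mu (ssub_j 0 (shift_k 0 M) J))).
Proof.
  simpl. apply conv_abs. eapply rst_trans; [apply conv_beta|].
  rewrite ssub_j_0, sub_ren. apply rst_sym.
  eapply rst_trans; [now apply conv_cps_sub_jump|].
  apply clos_rst_eq. f_equal. ext_var. now rewrite shift_k_0, cps_ren.
Qed.

Lemma conv_cps_Lam_App_value V : is_value V = true ->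
  conv (cps (Lam (App (shift_t 0 V) (Var 0)))) (cps V).
Proof.
  intro H. rewrite shift_t_0. simpl.
  rewrite is_value_ren, H, cps_val_ren, (cps_value V) by assumption.
  apply conv_ret, (conv_eta Ord).
Qed.

Lemma conv_cps_Mu_Jmp M : conv (cps (Mu (Jmp 0 (shift_k 0 M)))) (cps M).
Proof. rewrite shift_k_0. simpl. rewrite cps_ren. apply (conv_eta Cont). Qed.

Lemma conv_cps_Jmp_Mu l J : conv (cps_jump (Jmp l (Mu J))) (cps_jump (rename_kj 0 l J)).
Proof.
  simpl. eapply rst_trans; [apply conv_beta|].
  rewrite rename_kj_0, cps_jump_ren, <- sub_var_ren. apply clos_rst_eq. f_equal. ext_var.
Qed.

Lemma conv_cps_step t t' (H : step_t t t') : conv (cps t) (cps t')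
with conv_cps_step_jump J J' (H : step_j J J') : conv (cps_jump J) (cps_jump J').
Proof.
  - destruct H as [N M H|V N HV HN|M V H|M V H|M J|V H|M|M|M M' H|M M' N H|M N N' H|L L' M H
      |L M M' H|J J' H].
    + simpl. rewrite H, shift_t_0, is_value_ren, cps_ren, cps_val_ren. apply rst_refl.
    + simpl. rewrite HV, HN, shift_t_0, is_value_ren, HV, cps_val_ren. apply rst_refl.
    + eapply rst_trans; [|apply rst_sym, conv_cps_Where_value, H].
      simpl. rewrite H. apply conv_beta.
    + eapply rst_trans; [apply conv_cps_Where_value, H|].
      apply rst_sym, conv_cps_subst_t, H.
    + apply conv_cps_Where_Mu.
    + apply conv_cps_Lam_App_value, H.
    + apply conv_bind_ret_var.
    + apply conv_cps_Mu_Jmp.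
    + now apply conv_ret, conv_abs, conv_cps_step.
    + apply conv_cps_App_congr; [now apply conv_cps_step|apply rst_refl].
    + apply conv_cps_App_congr; [apply rst_refl|now apply conv_cps_step].
    + apply conv_bind; [apply rst_refl|now apply conv_cps_step].
    + apply conv_bind; [now apply conv_cps_step|apply rst_refl].
    + now apply conv_abs, conv_cps_step_jump.
  - destruct H as [l J|k M M' H|J J' M H|J M M' H].
    + apply conv_cps_Jmp_Mu.
    + apply conv_app; [now apply conv_cps_step|apply rst_refl].
    + apply conv_app; [apply rst_refl|now apply conv_abs, conv_cps_step_jump].
    + apply conv_app; [now apply conv_cps_step|apply rst_refl].
Qed.

Lemma conv_cps_ec t t' (H : ec_t t t') : conv (cps t) (cps t')
with conv_cps_ec_jump J J' (H : ec_j J J') : conv (cps_jump J) (cps_jump J').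
Proof.
  - destruct H as [? ? [L M N|J M]|M M' H|M M' N H|M N N' H|L L' M H|L M M' H|J J' H].
    + simpl. rewrite shift_t_1, cps_ren. apply conv_bind_assoc.
    + simpl. rewrite shift_k_0, cps_ren. apply conv_bind_abs.
    + now apply conv_ret, conv_abs, conv_cps_ec.
    + apply conv_cps_App_congr; [now apply conv_cps_ec|apply rst_refl].
    + apply conv_cps_App_congr; [apply rst_refl|now apply conv_cps_ec].
    + apply conv_bind; [apply rst_refl|now apply conv_cps_ec].
    + apply conv_bind; [now apply conv_cps_ec|apply rst_refl].
    + now apply conv_abs, conv_cps_ec_jump.
  - destruct H as [? ? [J M N|k L M]|k M M' H|J J' M H|J M M' H].
    + simpl. rewrite shift_tj_1, cps_jump_ren. apply conv_app_bind.
    + apply conv_app_bind.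
    + apply conv_app; [now apply conv_cps_ec|apply rst_refl].
    + apply conv_app; [apply rst_refl|now apply conv_abs, conv_cps_ec_jump].
    + apply conv_app; [now apply conv_cps_ec|apply rst_refl].
Qed.

Lemma conv_cps_ccv_eq M N : ccv_eq M N -> conv (cps M) (cps N).
Proof.
  apply clos_rst_map. intros t t' [H|H]; [now apply conv_cps_step|].
  revert H. apply clos_rst_map, conv_cps_ec.
Qed.

(** * The grammar of CPS terms *)

Inductive val_form : tm -> Prop :=
| val_var n : val_form (var Ord n)
| val_abs p : comp_form p -> val_form (abs Ord p)
with comp_form : tm -> Prop :=
| comp_abs j : cmd_form j -> comp_form (abs Cont j)
| comp_app v w : val_form v -> val_form w -> comp_form (app Ord v w)
with cmd_form : tm -> Prop :=
| cmd_ret K v : cont_form K -> val_form v -> cmd_form (app Ord K v)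
| cmd_run p K : comp_form p -> cont_form K -> cmd_form (app Cont p K)
with cont_form : tm -> Prop :=
| cont_var k : cont_form (var Cont k)
| cont_abs j : cmd_form j -> cont_form (abs Ord j).

Lemma val_form_ren v (H : val_form v) : forall r, val_form (ren r v)
with comp_form_ren p (H : comp_form p) : forall r, comp_form (ren r p)
with cmd_form_ren j (H : cmd_form j) : forall r, cmd_form (ren r j)
with cont_form_ren K (H : cont_form K) : forall r, cont_form (ren r K).
Proof.
  all: destruct H; intro r; simpl; constructor; auto.
Qed.

Lemma forms_ren_inv t : forall r,
  (val_form (ren r t) -> val_form t) /\ (comp_form (ren r t) -> comp_form t) /\
  (cmd_form (ren r t) -> cmd_form t) /\ (cont_form (ren r t) -> cont_form t).
Proof.
  induction t as [k n|k t IH|k t IHt u IHu]; intro r; repeat split; intro H;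
    inversion H; subst; constructor;
    solve [eapply IH; eassumption | eapply IHt; eassumption | eapply IHu; eassumption].
Qed.

Definition subst_form (s : subst) : Prop :=
  (forall n, val_form (s Ord n)) /\ (forall k, cont_form (s Cont k)).

Lemma subst_form_lift k s : subst_form s -> subst_form (lift k s).
Proof.
  intros [HO HC]. split; intro n; destruct k; try destruct n; try constructor;
    now apply val_form_ren || apply cont_form_ren.
Qed.

Lemma subst_form_inst_Ord v : val_form v -> subst_form (inst Ord v).
Proof. intro H. split; [intros [|n]|intro k]; [exact H|constructor|constructor]. Qed.

Lemma subst_form_inst_Cont K : cont_form K -> subst_form (inst Cont K).
Proof. intro H. split; [intro n|intros [|k]]; [constructor|exact H|constructor]. Qed.

Lemma val_form_sub v (H : val_form v) : forall s, subst_form s -> val_form (sub s v)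
with comp_form_sub p (H : comp_form p) : forall s, subst_form s -> comp_form (sub s p)
with cmd_form_sub j (H : cmd_form j) : forall s, subst_form s -> cmd_form (sub s j)
with cont_form_sub K (H : cont_form K) : forall s, subst_form s -> cont_form (sub s K).
Proof.
  all: destruct H; intros s Hs; simpl; try apply Hs;
    constructor; auto using subst_form_lift.
Qed.

Lemma ret_form v : val_form v -> comp_form (ret v).
Proof. intro H. repeat constructor. now apply val_form_ren. Qed.

Lemma bind_form q p : comp_form q -> comp_form p -> comp_form (bind q p).
Proof. intros Hq Hp. repeat constructor; now apply comp_form_ren. Qed.

Lemma call_form b v w q : val_form v -> (b = true -> val_form w) -> comp_form q ->
  comp_form (call b v w q).
Proof.
  intros Hv Hw Hq. destruct b; unfold call; [now constructor; auto|].
  apply bind_form; [assumption|]. constructor; [now apply val_form_ren|constructor].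
Qed.

Lemma cps_form (t : term) : comp_form (cps t)
with cps_val_form (t : term) : is_value t = true -> val_form (cps_val t)
with cps_jump_form (J : jump) : cmd_form (cps_jump J).
Proof.
  - destruct t as [n|M|M N|L M|J]; cbn.
    + apply ret_form. constructor.
    + apply ret_form. now constructor.
    + destruct (is_value M) eqn:E; [now apply call_form; auto|].
      apply bind_form; [apply cps_form|]. apply call_form; [constructor| |].
      * intro. now apply val_form_ren, cps_val_form.
      * apply comp_form_ren, cps_form.
    + now apply bind_form.
    + now constructor.
  - destruct t; intro H; try discriminate; constructor. apply cps_form.
  - destruct J; repeat constructor; apply cps_form || apply cps_jump_form.
Qed.

(** * Reading CPS terms back *)

(* [plug K t] reads back the term [t] in the continuation [K]. The values on terms
   outside of the grammar are irrelevant. *)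
Fixpoint read_val (v : tm) : term :=
  match v with
  | var _ n => Var n
  | abs _ p => Lam (read_comp p)
  | app _ _ _ => Var 0
  end
with read_comp (p : tm) : term :=
  match p with
  | var _ n => Var n
  | abs _ j => mu_eta (read_cmd j)
  | app _ v w => App (read_val v) (read_val w)
  end
with read_cmd (j : tm) : jump :=
  match j with
  | app Ord K v => plug K (read_val v)
  | app Cont p K => plug K (read_comp p)
  | _ => Jmp 0 (Var 0)
  end
with plug (K : tm) (t : term) : jump :=
  match K with
  | var _ k => Jmp k t
  | abs _ j => JWhere (read_cmd j) t
  | app _ _ _ => Jmp 0 t
  end.

Definition read_ctx (K : tm) : ctx :=
  match K with
  | var _ k => jmp_ctx k
  | abs _ j => where_ctx (target (read_cmd j)) (body (read_cmd j))
  | app _ _ _ => jmp_ctx 0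
  end.

Lemma cong_plug_fill K t : cong_jump (plug K t) (fill (read_ctx K) t).
Proof.
  destruct K as [k n|k j|k u v]; simpl; [apply rst_refl| |apply rst_refl].
  eapply rst_trans; [apply cong_JWhere, cong_jump_Jmp_target_body|].
  apply rst_sym, rst_step, ecj_ax, E3.
Qed.

Lemma mred_plug K t t' : mred t t' -> mred_jump (plug K t) (plug K t').
Proof.
  intro H. destruct K; simpl; [now apply mred_Jmp| |now apply mred_Jmp].
  apply mred_JWhere; [apply rt_refl|assumption].
Qed.

Lemma read_val_ren v (H : val_form v) : forall r,
  read_val (ren r v) = ren_term r (read_val v)
with read_comp_ren p (H : comp_form p) : forall r,
  read_comp (ren r p) = ren_term r (read_comp p)
with read_cmd_ren j (H : cmd_form j) : forall r,
  read_cmd (ren r j) = ren_jump r (read_cmd j)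
with plug_ren K (H : cont_form K) : forall r t,
  plug (ren r K) (ren_term r t) = ren_jump r (plug K t).
Proof.
  - destruct H; intro r; simpl; [reflexivity|]. now rewrite read_comp_ren.
  - destruct H; intro r; simpl.
    + now rewrite read_cmd_ren, mu_eta_ren.
    + now rewrite !read_val_ren.
  - destruct H; intro r; simpl.
    + now rewrite read_val_ren, plug_ren.
    + now rewrite read_comp_ren, plug_ren.
  - destruct H; intros r t; simpl; [reflexivity|]. now rewrite read_cmd_ren.
Qed.

Lemma read_ctx_ren K r : cont_form K -> read_ctx (ren r K) = ren_ctx r (read_ctx K).
Proof.
  intros [k|j H]; simpl; [reflexivity|]. now rewrite read_cmd_ren, target_ren, body_ren.
Qed.

Lemma cong_plug_Where K L t : cont_form K ->
  cong_jump (plug K (Where L t)) (JWhere (plug (wk Ord K) L) t).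
Proof.
  intros [k|j H]; simpl; apply rst_step, ecj_ax; [apply E3|].
  rewrite read_cmd_ren, <- shift_tj_1 by assumption. apply E1j.
Qed.

Definition read_terms (s : subst) (n : nat) : term := read_val (s Ord n).
Definition read_ctxs (s : subst) (k : nat) : ctx := read_ctx (s Cont k).

Lemma read_terms_lift k s :
  subst_form s -> read_terms (lift k s) = lift_terms k (read_terms s).
Proof.
  intros [H _]. extensionality n. unfold read_terms, lift_terms.
  destruct k; [destruct n; [reflexivity|]|]; now apply read_val_ren.
Qed.

Lemma read_ctxs_lift k s :
  subst_form s -> read_ctxs (lift k s) = lift_ctxs k (read_ctxs s).
Proof.
  intros [_ H]. extensionality n. unfold read_ctxs, lift_ctxs.
  destruct k; [|destruct n; [reflexivity|]]; now apply read_ctx_ren.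
Qed.

Lemma mred_read_val_sub v (H : val_form v) : forall s, subst_form s ->
  mred (sub_term (read_terms s) (read_ctxs s) (read_val v)) (read_val (sub s v))
with mred_read_comp_sub p (H : comp_form p) : forall s, subst_form s ->
  mred (sub_term (read_terms s) (read_ctxs s) (read_comp p)) (read_comp (sub s p))
with mred_read_cmd_sub j (H : cmd_form j) : forall s, subst_form s ->
  mred_jump (sub_jump (read_terms s) (read_ctxs s) (read_cmd j)) (read_cmd (sub s j))
with mred_plug_sub K (H : cont_form K) : forall s t, subst_form s ->
  mred_jump (sub_jump (read_terms s) (read_ctxs s) (plug K t))
    (plug (sub s K) (sub_term (read_terms s) (read_ctxs s) t)).
Proof.
  - destruct H as [n|p H]; intros s Hs; cbn; [apply rt_refl|].
    rewrite <- read_terms_lift, <- read_ctxs_lift by assumption.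
    apply mred_Lam, mred_read_comp_sub; auto using subst_form_lift.
  - destruct H as [j H|v w Hv Hw]; intros s Hs; cbn.
    + eapply rt_trans; [apply mred_sub_mu_eta|]. apply mred_mu_eta.
      rewrite <- read_terms_lift, <- read_ctxs_lift by assumption.
      apply mred_read_cmd_sub; auto using subst_form_lift.
    + apply mred_App; now apply mred_read_val_sub.
  - destruct H as [K v HK Hv|p K Hp HK]; intros s Hs; cbn.
    + eapply rt_trans; [now apply mred_plug_sub|]. now apply mred_plug, mred_read_val_sub.
    + eapply rt_trans; [now apply mred_plug_sub|]. now apply mred_plug, mred_read_comp_sub.
  - destruct H as [k|j H]; intros s t Hs; cbn.
    + apply red_mod_eqv, rst_sym, cong_plug_fill.
    + rewrite <- read_terms_lift, <- read_ctxs_lift by assumption.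
      apply mred_JWhere; [|apply rt_refl].
      apply mred_read_cmd_sub; auto using subst_form_lift.
Qed.

(** * Reductions of CPS terms are simulated by their read-back *)

Lemma mred_JWhere_value J V : is_value V = true ->
  mred_jump (JWhere J V) (sub_jump (scons V Var) jmp_ctx J).
Proof.
  intro H. eapply rt_trans; [apply red_mod_eqv, (cong_jump_Jmp_target_body (JWhere J V))|].
  simpl. eapply rt_trans; [apply mred_Jmp, red_mod_step, r_where_val, H|].
  rewrite subst_t_0. apply red_mod_eqv, (cong_fill_sub_body J (scons V Var) jmp_ctx).
Qed.

Lemma mred_fill_Mu a J :
  mred_jump (fill a (Mu J)) (sub_jump Var (scons a jmp_ctx) J).
Proof.
  assert (R : forall l I, mred_jump (Jmp l (Mu I)) (ren_jump (kcons Cont l idr) I)).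
  { intros. rewrite <- rename_kj_0. apply red_mod_step, r_jmp_mu. }
  destruct a as [l|l L]; simpl.
  - eapply rt_trans; [apply R|]. rewrite <- (sub_jump_id (ren_jump _ J)), sub_jump_ren.
    apply clos_rt_eq. f_equal. extensionality k. now destruct k.
  - eapply rt_trans; [apply mred_Jmp, red_mod_step, r_where_mu|].
    eapply rt_trans; [apply R|]. rewrite ssub_j_0, ren_jump_sub.
    apply clos_rt_eq. f_equal. extensionality k. destruct k; [|reflexivity].
    cbn. now rewrite shift_k_0, up_Ord_kcons_Cont, ren_kcons_wk_term.
Qed.

Lemma mred_plug_mu_eta K J :
  mred_jump (plug K (mu_eta J)) (sub_jump Var (scons (read_ctx K) jmp_ctx) J).
Proof.
  eapply rt_trans; [apply red_mod_eqv, cong_plug_fill|].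
  destruct (mu_etaP J) as [T F|_]; [|apply mred_fill_Mu].
  apply red_mod_eqv. eapply rst_trans; [|apply cong_fill_sub_body].
  rewrite T. rewrite <- (wk_lower_cont (body J)) at 2 by assumption.
  rewrite sub_scons_wk_term. apply rst_refl.
Qed.

Lemma read_terms_inst_Ord v : read_terms (inst Ord v) = scons (read_val v) Var.
Proof. extensionality n. now destruct n. Qed.

Lemma read_ctxs_inst_Cont K : read_ctxs (inst Cont K) = scons (read_ctx K) jmp_ctx.
Proof. extensionality k. now destruct k. Qed.

Lemma is_value_read_val v : val_form v -> is_value (read_val v) = true.
Proof. now intros [n|p _]. Qed.

Lemma mred_read_comp_beta p v : comp_form p -> val_form v ->
  mred (App (Lam (read_comp p)) (read_val v)) (read_comp (sub (inst Ord v) p)).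
Proof.
  intros Hp Hv. eapply rt_trans; [apply red_mod_step, r_beta, is_value_read_val, Hv|].
  eapply rt_trans; [apply red_mod_step, r_where_val, is_value_read_val, Hv|].
  rewrite subst_t_0, <- read_terms_inst_Ord.
  apply (mred_read_comp_sub p Hp (inst Ord v)). now apply subst_form_inst_Ord.
Qed.

Lemma mred_read_cmd_beta_Ord j v : cmd_form j -> val_form v ->
  mred_jump (JWhere (read_cmd j) (read_val v)) (read_cmd (sub (inst Ord v) j)).
Proof.
  intros Hj Hv. eapply rt_trans; [apply mred_JWhere_value, is_value_read_val, Hv|].
  rewrite <- read_terms_inst_Ord.
  apply (mred_read_cmd_sub j Hj (inst Ord v)). now apply subst_form_inst_Ord.
Qed.

Lemma mred_read_cmd_beta_Cont j K : cmd_form j -> cont_form K ->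
  mred_jump (plug K (mu_eta (read_cmd j))) (read_cmd (sub (inst Cont K) j)).
Proof.
  intros Hj HK. eapply rt_trans; [apply mred_plug_mu_eta|].
  rewrite <- read_ctxs_inst_Cont.
  apply (mred_read_cmd_sub j Hj (inst Cont K)). now apply subst_form_inst_Cont.
Qed.

Lemma mred_JWhere_plug_Var K u : cont_form K ->
  mred_jump (JWhere (plug (wk Ord K) (Var 0)) u) (plug K u).
Proof.
  intro HK. eapply rt_trans; [apply red_mod_eqv, rst_sym, cong_plug_Where, HK|].
  apply mred_plug, red_mod_step, r_where_var.
Qed.

Record simulated (t t' : tm) : Prop := {
  sim_val : val_form t -> val_form t' /\ mred (read_val t) (read_val t');
  sim_comp : comp_form t -> comp_form t' /\ mred (read_comp t) (read_comp t');
  sim_cmd : cmd_form t -> cmd_form t' /\ mred_jump (read_cmd t) (read_cmd t');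
  sim_cont : cont_form t -> cont_form t' /\ forall u, mred_jump (plug t u) (plug t' u) }.

Ltac invert_forms := repeat match goal with
  | H : _ (abs _ _) |- _ => inversion H; clear H; subst
  | H : _ (app _ _ _) |- _ => inversion H; clear H; subst
  end.

Lemma simulated_var k n : simulated (var k n) (var k n).
Proof. split; intro F; split; trivial; intros; apply rt_refl. Qed.

Lemma simulated_abs k t t' : simulated t t' -> simulated (abs k t) (abs k t').
Proof.
  intros [_ Hp Hj _]. split; intro F; invert_forms.
  - destruct Hp as [? ?]; [assumption|]. split; [now constructor|now apply mred_Lam].
  - destruct Hj as [? ?]; [assumption|]. split; [now constructor|now apply mred_mu_eta].
  - destruct Hj as [? ?]; [assumption|]. split; [now constructor|]. intro u.
    apply mred_JWhere; [assumption|apply rt_refl].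
Qed.

Lemma simulated_app k t t' u u' : simulated t t' -> simulated u u' ->
  simulated (app k t u) (app k t' u').
Proof.
  intros [Ht Htp _ HtK] [Hu _ _ HuK]. split; intro F; invert_forms.
  - destruct Ht as [? ?], Hu as [? ?]; trivial. split; [now constructor|now apply mred_App].
  - destruct HtK as [? R], Hu as [? ?]; trivial. split; [now constructor|].
    eapply rt_trans; [apply R|now apply mred_plug].
  - destruct Htp as [? ?], HuK as [? R]; trivial. split; [now constructor|].
    eapply rt_trans; [apply R|now apply mred_plug].
Qed.

Lemma simulated_beta k t t' u u' : simulated t t' -> simulated u u' ->
  simulated (app k (abs k t) u) (sub (inst k u') t').
Proof.
  intros [_ Htp Htj _] [Hu _ _ HuK]. split; intro F; invert_forms.
  - destruct Htp as [? ?], Hu as [? ?]; trivial.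
    split; [apply comp_form_sub; auto using subst_form_inst_Ord|].
    eapply rt_trans; [|now apply mred_read_comp_beta].
    apply mred_App; auto using mred_Lam.
  - destruct Htj as [? ?], Hu as [? ?]; trivial.
    split; [apply cmd_form_sub; auto using subst_form_inst_Ord|].
    eapply rt_trans; [|now apply mred_read_cmd_beta_Ord]. now apply mred_JWhere.
  - destruct Htj as [? ?], HuK as [? R]; trivial.
    split; [apply cmd_form_sub; auto using subst_form_inst_Cont|].
    eapply rt_trans; [|now apply mred_read_cmd_beta_Cont].
    eapply rt_trans; [apply R|now apply mred_plug, mred_mu_eta].
Qed.

Lemma simulated_eta k t t' : simulated t t' -> simulated (abs k (eta_body k t)) t'.
Proof.
  unfold eta_body. intros [Hv Hp _ HK]. split; intro F; invert_forms.
  - assert (Ht : val_form t) by (now apply (forms_ren_inv t (shift Ord))).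
    destruct Hv as [? ?]; [assumption|]. split; [assumption|].
    eapply rt_trans; [|eassumption]. simpl. rewrite read_val_ren by assumption.
    rewrite <- shift_t_0.
    now apply red_mod_step, r_eta, is_value_read_val.
  - assert (Ht : comp_form t) by (now apply (forms_ren_inv t (shift Cont))).
    destruct Hp as [? ?]; [assumption|]. split; [assumption|].
    simpl. rewrite read_comp_ren by assumption.
    now rewrite (mu_eta_eq _ (read_comp t)).
  - assert (Ht : cont_form t) by (now apply (forms_ren_inv t (shift Ord))).
    destruct HK as [? R]; [assumption|]. split; [assumption|]. intro u.
    eapply rt_trans; [now apply mred_JWhere_plug_Var|apply R].
Qed.

Lemma par_simulated t t' : par t t' -> simulated t t'.
Proof.
  induction 1; auto using simulated_var, simulated_abs, simulated_app, simulated_beta,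
    simulated_eta.
Qed.

Lemma mred_read_comp_Rstar p q : Rstar tm par p q -> comp_form p ->
  mred (read_comp p) (read_comp q).
Proof.
  induction 1 as [p|p q r H _ IH]; intro F; [apply rt_refl|].
  destruct (sim_comp _ _ (par_simulated _ _ H) F) as [F' R].
  eapply rt_trans; [exact R|now apply IH].
Qed.

(** * Terms reduce to the read-back of their translation *)

Lemma read_comp_ret v : val_form v -> read_comp (ret v) = read_val v.
Proof. intro H. apply mu_eta_eq; [reflexivity|]. apply read_val_ren, H. Qed.

Lemma read_comp_bind q p : comp_form q -> comp_form p ->
  read_comp (bind q p) = Where (read_comp p) (read_comp q).
Proof.
  intros Hq Hp. apply mu_eta_eq; [reflexivity|]. simpl.
  rewrite !read_comp_ren by assumption. simpl. do 2 f_equal. ext_var.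
Qed.

Lemma mred_read_call v w q N : val_form v -> comp_form q ->
  mred N (read_comp q) -> (is_value N = true -> mred N (read_val w)) ->
  mred (App (read_val v) N) (read_comp (call (is_value N) v w q)).
Proof.
  intros Hv Hq Rq Rw. unfold call. destruct (is_value N) eqn:E; cbn.
  - apply mred_App; [apply rt_refl|now apply Rw].
  - eapply rt_trans; [apply red_mod_step, r_app_vn; [now apply is_value_read_val|exact E]|].
    rewrite read_comp_bind;
      [|assumption|constructor; [now apply val_form_ren|constructor]].
    apply mred_Where; [|exact Rq]. cbn.
    rewrite read_val_ren, shift_t_0 by assumption. apply rt_refl.
Qed.

Lemma mred_read_call_wk w q N : (is_value N = true -> val_form w) -> comp_form q ->
  mred N (read_comp q) -> (is_value N = true -> mred N (read_val w)) ->
  mred (App (Var 0) (shift_t 0 N))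
    (read_comp (call (is_value N) (var Ord 0) (wk Ord w) (wk Ord q))).
Proof.
  intros Hw Hq Rq Rw. rewrite shift_t_0, <- (is_value_ren (shift Ord) N).
  apply (mred_read_call (var Ord 0)).
  - constructor.
  - now apply comp_form_ren.
  - rewrite read_comp_ren by assumption. now apply mred_ren.
  - rewrite is_value_ren. intro E.
    rewrite read_val_ren by now apply Hw. now apply mred_ren, Rw.
Qed.

Lemma mred_read_cps (t : term) : mred t (read_comp (cps t))
with mred_read_cps_val (t : term) : is_value t = true -> mred t (read_val (cps_val t))
with mred_read_cps_jump (J : jump) : mred_jump J (read_cmd (cps_jump J)).
Proof.
  - destruct t as [n|M|M N|L M|J]; cbn.
    + rewrite read_comp_ret by constructor. apply rt_refl.
    + rewrite read_comp_ret by (constructor; apply cps_form). now apply mred_Lam.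
    + destruct (is_value M) eqn:E.
      * apply rt_trans with (App (read_val (cps_val M)) N).
        -- apply mred_App; [now apply mred_read_cps_val|apply rt_refl].
        -- apply mred_read_call; auto using cps_form, cps_val_form.
      * eapply rt_trans; [apply red_mod_step, r_app_nv, E|]. rewrite read_comp_bind.
        -- apply mred_Where; [|apply mred_read_cps].
           apply mred_read_call_wk; auto using cps_form, cps_val_form.
        -- apply cps_form.
        -- apply call_form; [constructor| |apply comp_form_ren, cps_form].
           intro EN. now apply val_form_ren, cps_val_form.
    + rewrite read_comp_bind by apply cps_form. now apply mred_Where.
    + eapply rt_trans; [apply mred_Mu_mu_eta|]. now apply mred_mu_eta.
  - destruct t; intro H; try discriminate; [apply rt_refl|now apply mred_Lam].
  - destruct J; cbn; [now apply mred_Jmp|now apply mred_JWhere].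
Qed.

Lemma reds_read_Rstar_cps M Q : Rstar tm par (cps M) Q -> reds M (read_comp Q).
Proof.
  intro H. apply mred_reds. apply rt_trans with (read_comp (cps M)).
  - apply mred_read_cps.
  - apply mred_read_comp_Rstar; [exact H|apply cps_form].
Qed.

Theorem theorem2p1 : forall M1 M2 : term,
  ccv_eq M1 M2 -> exists N : term, reds M1 N /\ reds M2 N.
Proof.
  intros M1 M2 H. apply conv_cps_ccv_eq in H.
  apply (strongly_confluent_church_rosser par par_diamond) in H as [Q [H1 H2]].
  exists (read_comp Q). split; now apply reds_read_Rstar_cps.
Qed.
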